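(* Let $1<p<\infty$, let $\alpha\in(0,1)\setminus\mathbb{Q}$, and let $(p_n/q_n)$ be the continued-fraction convergents of $\alpha$. If for every $n$ there is $n_0\ge n$ such that $$q_{n_0+1}>\psi_{1,p}(q_{n_0}),$$ then the constant function $1$ is cyclic for the Bishop operator $T_\alpha$ on $L^p[0,1]$.
   Context: $L^p[0,1]$ is the complex space. For $\alpha\in(0,1)$ the Bishop operator is $(T_\alpha f)(t)=t\,f(\{t+\alpha\})$, where $\{\cdot\}$ is the fractional part. A vector $f\in L^p[0,1]$ is cyclic for $T_\alpha$ if the closed linear span of $\{T_\alpha^n f:n\ge0\}$ is $L^p[0,1]$. The function $\psi_{1,p}:\{1,2,3,\dots\}\to(0,\infty)$ is defined as follows ($\log$ is the natural logarithm, $\mathrm e=\exp(1)$). For every integer $q\ge2$ put $$s_q=\frac{q(q-1)}2,\quad \ell_q=\frac{(q-1)(q-2)}2,\quad \varepsilon_q=\frac1{q+1},\quad b_q=q^{-s_q},\quad W_q=\frac{q!}{q^q},$$ $$\eta_q=\begin{cases} b_q/2,& q=2,\\ \dfrac{b_q}{2}\left(\dfrac{\varepsilon_q^p}{8}\right)^{\ell_q},& q\ge3,\end{cases}\qquad a_q=\frac{\varepsilon_q^p}{8q},\quad H_q=\frac{q!}{\eta_q},\quad \Gamma_q=3+\frac4{W_q},$$ $$L_q=\frac{H_q}{a_q}+\frac{q!\,q(q-1+\pi)}{\eta_q}+\frac{2(q!)^2q^2}{\eta_q^2},$$ $$\Lambda_q=\max\left\{1,\frac{\pi qL_q}{\varepsilon_q}\right\},\qquad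 N_q=\left\lceil4\Lambda_q\log(4\Lambda_q+\mathrm e)\right\rceil,\qquad d_q=qN_q+q-1,$$ $$C_q=3qH_qN_q\Gamma_q^{N_q},\qquad \delta_q=\min\left\{\frac{1}{2d_q},\ \frac{\varepsilon_q^p}{4C_q^p d_q^{p+1}}\right\}.$$ Then $\psi_{1,p}(1)=1$ and $\psi_{1,p}(q)=\dfrac1{q\,\delta_q}$ for $q\ge2$. *)

(* Defs.v *)
From HB Require Import structures.
From mathcomp Require Import all_boot all_order all_algebra.
From mathcomp Require Import all_classical all_reals all_analysis.
From mathcomp Require Import complex.
Import Order.TTheory GRing.Theory Num.Theory.
Import numFieldNormedType.Exports.

Set Implicit Arguments.
Unset Strict Implicit.
Unset Printing Implicit Defensive.

Local Open Scope classical_set_scope.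
Local Open Scope ring_scope.

(* Complex L^p spaces are handled through representatives: an element is an
   everywhere-defined measurable function, and convergence is with respect to
   the L^p seminorm, which vanishes exactly on the functions that are 0 a.e. *)
Definition cLnorm d (T : measurableType d) (R : realType)
    (mu : {measure set T -> \bar R}) (p : R) (f : T -> R[i]) : \bar R :=
  'N[mu]_(p%:E)[EFin \o (@Normc.normc R \o f)]%E.

Definition cLfun d (T : measurableType d) (R : realType)
    (mu : {measure set T -> \bar R}) (p : R) : set (T -> R[i]) :=
  [set f | [/\ measurable_fun setT (fun x => complex.Re (f x)),
               measurable_fun setT (fun x => complex.Im (f x)) &
               (cLnorm mu p f < +oo)%E]].

Definition cspan (T : Type) (R : realType) (S : set (T -> R[i])) :
    set (T -> R[i]) :=
  [set f | exists (n : nat) (c : 'I_n -> R[i]) (h : 'I_n -> T -> R[i]),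
     (forall k, S (h k)) /\ f = (fun x => \sum_(k < n) c k * h k x)].

Definition cLclosure d (T : measurableType d) (R : realType)
    (mu : {measure set T -> \bar R}) (p : R) (S : set (T -> R[i])) :
    set (T -> R[i]) :=
  [set g | cLfun mu p g /\
     forall e : R, 0 < e ->
       exists2 h, S h & (cLnorm mu p (fun x => (g x - h x)%R) < e%:E)%E].

Definition cyclic_vector d (T : measurableType d) (R : realType)
    (mu : {measure set T -> \bar R}) (p : R)
    (A : (T -> R[i]) -> T -> R[i]) (f : T -> R[i]) : Prop :=
  cLfun mu p f /\
  cLclosure mu p (cspan [set iter n A f | n in [set: nat]]) = cLfun mu p.

(* Lebesgue measure on [0,1], carried by the whole line: the values of a
   function outside [0,1] are irrelevant. *)
Definition leb01 (R : realType) :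
    {measure set (measurableTypeR R) -> \bar R} :=
  mrestr (@lebesgue_measure R) (measurable_itv `[0 : R, 1 : R]).

Definition fracpart (R : realType) (x : R) : R := x - (Num.floor x)%:~R.

Definition bishop (R : realType) (alpha : R) (f : R -> R[i]) : R -> R[i] :=
  fun t => t%:C%C * f (fracpart (t + alpha)).

(* Continued fraction x = [a_0; a_1, a_2, ...] of an irrational x: cf_complete
   gives the complete quotients x_0 = x, x_(n+1) = 1 / {x_n}, and
   a_n = floor x_n.  As x_n > 1 for n >= 1, truncn is the floor there; the
   denominators of the convergents do not depend on a_0. *)
Definition cf_complete (R : realType) (x : R) (n : nat) : R :=
  iter n (fun y => (fracpart y)^-1) x.

Definition cf_quot (R : realType) (x : R) (n : nat) : nat :=
  Num.truncn (cf_complete x n).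

Fixpoint cf_den (R : realType) (x : R) (n : nat) : nat :=
  match n with
  | 0 => 1
  | m.+1 => match m with
            | 0 => cf_quot x 1
            | k.+1 => cf_quot x n * cf_den x m + cf_den x k
            end
  end%N.

(* The auxiliary quantities below are only meaningful for q >= 2. *)
Section Psi.
Variables (R : realType) (p : R) (q : nat).

Definition psi_s : nat := (q * (q - 1)) %/ 2.
Definition psi_ell : nat := ((q - 1) * (q - 2)) %/ 2.
Definition psi_eps : R := (q%:R + 1)^-1.
Definition psi_b : R := (q%:R ^+ psi_s)^-1.
Definition psi_W : R := q`!%:R / q%:R ^+ q.
Definition psi_eta : R :=
  if q == 2 then psi_b / 2
  else psi_b / 2 * (psi_eps `^ p / 8) ^+ psi_ell.
Definition psi_a : R := psi_eps `^ p / (8 * q%:R).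
Definition psi_H : R := q`!%:R / psi_eta.
Definition psi_Gamma : R := 3 + 4 / psi_W.
Definition psi_L : R :=
  psi_H / psi_a + q`!%:R * q%:R * (q%:R - 1 + pi) / psi_eta
  + 2 * q`!%:R ^+ 2 * q%:R ^+ 2 / psi_eta ^+ 2.
Definition psi_Lambda : R := Num.max 1 (pi * q%:R * psi_L / psi_eps).
(* The argument of the ceiling is positive, so absz only casts to nat. *)
Definition psi_N : nat :=
  `|Num.ceil (4 * psi_Lambda * ln (4 * psi_Lambda + expR 1))|%N.
Definition psi_d : nat := (q * psi_N + q - 1)%N.
Definition psi_C : R := 3 * q%:R * psi_H * psi_N%:R * psi_Gamma ^+ psi_N.
Definition psi_delta : R :=
  Num.min (1 / (2 * psi_d%:R))
          (psi_eps `^ p / (4 * psi_C `^ p * psi_d%:R `^ (p + 1))).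

(* psi_{1,p}(q); the value at q = 0, outside the domain, is arbitrary. *)
Definition psi1 : R := if (q <= 1)%N then 1 else 1 / (q%:R * psi_delta).

End Psi.

(* Main.v *)
(* Let q = q_n be a denominator with q_(n+1) > psi1 q and r = P/q the
   corresponding convergent, so that |alpha - r| < psi_delta q.  For t in the
   residue class u = {q t} the values of T_r^(Nq+k) 1 are w(u)^N M(u)_(m,k),
   where w(u) is the product of T_r over a full period and M(u) a q x q matrix
   of products (m indexes the q translates of u/q).  A function that is constant
   on the intervals of length 1/q is reproduced by the coefficients
   c(u) = M(u)^-1 G; regularised where det M(u) is small, each c_k is a Lipschitz
   function of w(u), and Bernstein's theorem makes it a polynomial in w(u).
   M(0) is triangular, so det M(0) >= q^-(q(q-1)/2), and a Remez-type inequality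
   turns this into |det M(u)| >= q^-(q(q-1)/2) k^-(q^2) off a set of small
   measure, with k independent of q.  The Bernstein degree needed is thus
   about q^(2q^2 + o(q^2)), while psi_N is at least about q^((1+p)q^2); as p > 1
   the latter wins for large q.  Finally psi_delta is small enough to replace
   T_r by T_alpha.  Hence every continuous function, and by density every L^p
   function, is a limit of combinations of the T_alpha^n 1. *)
Require Import Defs.
From mathcomp Require Import all_boot all_order all_algebra all_fingroup.
From mathcomp Require Import all_classical all_reals all_analysis.
From mathcomp Require Import complex measurable_realfun.
From mathcomp Require Import ring lra zify.
Import Order.TTheory GRing.Theory Num.Theory.
Import numFieldNormedType.Exports.
Set Implicit Arguments.
Unset Strict Implicit.
Unset Printing Implicit Defensive.
Local Open Scope ring_scope.

(** * Sublevel sets of polynomials *)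

(** On a class u the available coefficients are polynomials in the scalar w(u), so Lipschitz bounds
    in u must become bounds in w(u). This costs only a factor q^q: one factor of w(u) is u/q, and
    the others increase with u and are at least 1/q. Let tau be the threshold for the determinant
    and eta = theta tau the regularisation parameter. Up to factors q^O(q) the Lipschitz constant L
    of the coefficients is eta^-2, and the Bernstein error at degree N is a chosen small term plus
    L^2/N; hence N has to beat tau^-4. Here tau^-1 = q^(q(q-1)/2) k^(q^2) with k = 2Ke, where 2/K
    bounds the measure of the set of small determinant. K and theta depend only on p, the accuracy
    and a bound B of the function, so they are fixed before q. On the exceptional sets the error
    need only be controlled. Where the determinant is small it exceeds the usual error by at most B.
    Near the points j/q, where rotations by alpha and r may wrap differently, it is bounded through
    the sum of the absolute coefficients; this sum carries a factor 3^N, matched in [psi_C] by the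
    N-th power of [psi_Gamma], which is at least 3. *)

Section Remez.
Variable R : realFieldType.
Implicit Types (P : {poly R}) (x v : nat -> R).

(* By Neville's recursion for the interpolation polynomial. *)
Lemma interpolation_at0 (h tau : R) (n : nat) x v :
  0 < h ->
  (forall i j, (i < j <= n)%N -> (j - i)%:R * h <= x j - x i) ->
  (forall i, (i <= n)%N -> 0 <= x i <= 1) ->
  (forall i, (i <= n)%N -> `|v i| <= tau) ->
  exists P, [/\ (size P <= n.+1)%N,
    forall i, (i <= n)%N -> P.[x i] = v i &
    `|P.[0]| <= tau * (2 / h) ^+ n / n`!%:R].
Proof.
move=> h0; elim: n x v => [|n IH] x v sep x01 vt.
  exists (v 0)%:P; split => //.
  - exact: size_polyC_leq1.
  - by move=> i; rewrite leqn0 => /eqP->; rewrite hornerC.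
  - by rewrite hornerC expr0 fact0 divr1 mulr1 vt.
have [||| P0 [sP0 P0E P0b]] := IH x v.
- by move=> i j /andP[ij jn]; apply: sep; rewrite ij leqW.
- by move=> i ni; apply: x01; rewrite leqW.
- by move=> i ni; apply: vt; rewrite leqW.
have [||| P1 [sP1 P1E P1b]] := IH (fun i => x i.+1) (fun i => v i.+1).
- move=> i j /andP[ij jn].
  by rewrite -[(j - i)%N]/(j.+1 - i.+1)%N; apply: sep; rewrite ltnS ij.
- by move=> i ni; apply: x01.
- by move=> i ni; apply: vt.
set w := x n.+1 - x 0.
have wh : n.+1%:R * h <= w by rewrite /w -[X in X%:R * h](subn0 n.+1); apply: sep; rewrite ltnS leqnn.
have w0 : 0 < w by apply: lt_le_trans wh; rewrite mulr_gt0 // ltr0n.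
exists (w^-1 *: (('X - (x 0)%:P) * P1 - ('X - (x n.+1)%:P) * P0)); split.
- apply: leq_trans (size_scale_leq _ _) _.
  apply: leq_trans (size_polyD _ _) _; rewrite size_polyN geq_max.
  by apply/andP; split; apply: leq_trans (size_polyMleq _ _) _;
     rewrite size_XsubC.
- move=> i ni; rewrite !hornerE.
  have [->|i0] := eqVneq i 0%N.
    by rewrite P0E // subrr mul0r sub0r -mulNr opprB mulKf // gt_eqF.
  have [->|iN] := eqVneq i n.+1.
    by rewrite P1E // subrr mul0r subr0 mulKf // gt_eqF.
  have i1 : (i.-1 <= n)%N by rewrite -ltnS prednK ?lt0n.
  have i2 : (i <= n)%N by rewrite -ltnS ltn_neqAle iN.
  rewrite P0E //; have := P1E _ i1; rewrite prednK ?lt0n // => ->.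
  rewrite -mulrBl.
  rewrite (_ : x i - x 0 - _ = w); last by rewrite /w; ring.
  by rewrite mulKf // gt_eqF.
- set b := tau * (2 / h) ^+ n / n`!%:R in P0b P1b.
  rewrite !hornerE.
  have xb i : (i <= n.+1)%N -> `|x i| <= 1.
    by move=> /x01 /andP[? ?]; rewrite ger0_norm.
  rewrite normrM normfV (gtr0_norm w0).
  (* A Neville step contributes the factor 2 / ((n+1) h): the two extreme nodes are at least (n+1) h
     apart, and both lie within distance 1 of 0. *)
  have -> : tau * (2 / h) ^+ n.+1 / n.+1`!%:R = (n.+1%:R * h)^-1 * (b + b).
    rewrite /b factS natrM exprSr; field.
    by rewrite !pnatr_eq0 -lt0n fact_gt0 /= addrC natr1 pnatr_eq0 /= gt_eqF.
  have b0 : 0 <= b by apply: le_trans P0b.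
  apply: ler_pM.
  + by rewrite invr_ge0 ltW.
  + by [].
  + by rewrite lef_pV2 ?posrE // mulr_gt0 // ltr0n.
  + apply: le_trans (ler_normB _ _) _; rewrite !normrM !normrN.
    apply: lerD; rewrite -[leRHS]mul1r; apply: ler_pM => //; exact: xb.
Qed.

(** Separation makes the n+1 nodes distinct, so P is the interpolation polynomial through its own
    values there. *)
Lemma poly_at0_le (h tau : R) (n : nat) P x :
  0 < h -> (size P <= n.+1)%N ->
  (forall i j, (i < j <= n)%N -> (j - i)%:R * h <= x j - x i) ->
  (forall i, (i <= n)%N -> 0 <= x i <= 1) ->
  (forall i, (i <= n)%N -> `|P.[x i]| <= tau) ->
  `|P.[0]| <= tau * (2 / h) ^+ n / n`!%:R.
Proof.
move=> h0 sP sep x01 Pt.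
have [Q [sQ QE Qb]] := interpolation_at0 h0 sep x01 Pt.
suff -> : P = Q by [].
apply/eqP; rewrite -subr_eq0; apply/eqP.
apply: (@roots_geq_poly_eq0 _ _ (map x (iota 0 n.+1))).
- rewrite all_map; apply/allP => i; rewrite mem_iota /= add0n ltnS => ni.
  by rewrite rootE !hornerE QE // subrr.
- rewrite map_inj_in_uniq ?iota_uniq // => i j.
  rewrite !mem_iota /= !add0n !ltnS => ni nj e.
  have pos a b : (a < b <= n)%N -> x a < x b.
    move=> /[dup] ab /sep; case/andP: ab => ab _ /(lt_le_trans _) H.
    by rewrite -subr_gt0 H // mulr_gt0 // ltr0n subn_gt0.
  have [ij|ji|//] := ltngtP i j.
    by have := @pos i j; rewrite ij nj e ltxx => /(_ isT).
  by have := @pos j i; rewrite ji ni e ltxx => /(_ isT).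
- rewrite size_map size_iota; apply: leq_trans (size_polyD _ _) _.
  by rewrite size_polyN geq_max sP sQ.
Qed.

Lemma nth_ltn_sorted (s : seq nat) i j :
  sorted ltn s -> (i < j < size s)%N -> (j - i <= nth 0 s j - nth 0 s i)%N.
Proof.
move=> ss /andP[]; elim: j => // j IH ij js.
have step : (nth 0%N s j < nth 0%N s j.+1)%N.
  by apply: (sorted_ltn_nth ltn_trans) => //; rewrite inE ltnW.
have [->|/eqP ne] := @eqP _ i j; first by rewrite subSnn subn_gt0.
have := IH _ (ltnW js); have : (i < j)%N by rewrite ltn_neqAle ne -ltnS.
move=> ij' /(_ ij'); lia.
Qed.

(** More than 2n bad cells would give n+1 points of small value, one from every second bad cell, and
    interpolation would make P(0) small. Every second cell is used because points of adjacent cells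
    may coincide. The bad cells have length 1/(Kn), so they cover at most 2/K of the unit interval,
    whatever the degree. *)
Lemma few_small_intervals (n K : nat) (tau : R) P (bad : pred nat) :
  (0 < n)%N -> (0 < K)%N -> (size P <= n.+1)%N ->
  tau * (2 * (K * n)%:R) ^+ n / n`!%:R < `|P.[0]| ->
  (forall i, (i < K * n)%N -> bad i ->
     exists u, [/\ i%:R <= (K * n)%:R * u, (K * n)%:R * u <= i.+1%:R &
                   `|P.[u]| <= tau]) ->
  (count bad (iota 0 (K * n)) <= 2 * n)%N.
Proof.
move=> n0 K0 sP big hbad; rewrite leqNgt; apply/negP => many.
set Q := (K * n)%N in hbad many big *.
have Q0 : (0 < Q)%N by rewrite muln_gt0 K0.
have QR0 : 0 < Q%:R :> R by rewrite ltr0n.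
set s := seq.filter bad (iota 0 Q).
have ss : sorted ltn s by apply: sorted_filter (iota_ltn_sorted _ _); exact: ltn_trans.
have szs : (2 * n < size s)%N by rewrite size_filter.
have sP' i : (i <= n)%N -> exists u : R, [/\ (nth 0 s (2 * i)%N)%:R <= Q%:R * u,
     Q%:R * u <= (nth 0 s (2 * i)%N).+1%:R & `|P.[u]| <= tau].
  move=> ni; have : nth 0%N s (2 * i)%N \in s.
    by apply: mem_nth; apply: leq_ltn_trans szs; rewrite leq_mul.
  rewrite mem_filter mem_iota add0n /= => /andP[b lt].
  exact: hbad.
have sltQ i : (i < size s)%N -> (nth 0%N s i < Q)%N.
  by move=> /(mem_nth 0%N); rewrite mem_filter mem_iota add0n => /and3P[].
have /choice[x xP] : forall i, exists u : R, (i <= n)%N ->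
    [/\ (nth 0 s (2 * i)%N)%:R <= Q%:R * u,
    Q%:R * u <= (nth 0 s (2 * i)%N).+1%:R & `|P.[u]| <= tau].
  move=> i; case: (leqP i n) => [ni|_]; last by exists 0.
  by have [u hu] := sP' i ni; exists u.
have : `|P.[0]| <= tau * (2 / Q%:R^-1) ^+ n / n`!%:R.
  apply: (@poly_at0_le _ _ _ _ x) => //.
  - by rewrite invr_gt0.
  - move=> i j /andP[ij jn].
    have [_ iu _] := xP i (leq_trans (ltnW ij) jn).
    have [jl _ _] := xP j jn.
    rewrite -(ler_pM2l QR0) mulrBr mulrCA divff ?gt_eqF // mulr1.
    have := @nth_ltn_sorted s (2 * i) (2 * j) ss.
    rewrite ltn_mul2l ij /= => /(_ (leq_ltn_trans _ szs)).
    rewrite leq_mul2l jn /= => /(_ isT) H.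
    (* The indices differ by at least 2 (j - i) >= (j - i) + 1; the extra 1 pays for the width of a
       cell. *)
    have : (j - i + (nth 0 s (2 * i)).+1 <= nth 0 s (2 * j))%N by lia.
    rewrite -(ler_nat R) natrD => H'.
    by rewrite lerBrDr; apply: le_trans jl; apply: le_trans H'; rewrite lerD2l.
  - move=> i ni; have [l u _] := xP i ni.
    have lt : (nth 0%N s (2 * i) < Q)%N.
      by apply: sltQ; apply: leq_ltn_trans szs; rewrite leq_mul.
    rewrite -(pmulr_rge0 _ QR0) (le_trans _ l) ?ler0n //=.
    rewrite -(ler_pM2l QR0) mulr1; apply: le_trans u _.
    by rewrite ler_nat.
  - by move=> i /xP[].
by rewrite invrK leNgt big.
Qed.
End Remez.

(** * Perturbation of determinants *)

Section ProductPerturbation.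
Variable R : realFieldType.

Lemma prod_norm_le1 (I : finType) (a : I -> R) :
  (forall i, `|a i| <= 1) -> `|\prod_i a i| <= 1.
Proof.
move=> a1; rewrite normr_prod.
by apply: prodr_ile1 => i _; rewrite normr_ge0 a1.
Qed.

Lemma prod_diff_le n (a b : nat -> R) :
  (forall i, (i < n)%N -> `|a i| <= 1) -> (forall i, (i < n)%N -> `|b i| <= 1) ->
  `|\prod_(i < n) a i - \prod_(i < n) b i| <= \sum_(i < n) `|a i - b i|.
Proof.
elim: n => [|n IH] a1 b1; first by rewrite !big_ord0 subrr normr0.
rewrite !big_ord_recr /=.
have IH' := IH (fun i h => a1 i (leqW h)) (fun i h => b1 i (leqW h)).
set A := \prod_(i < n) a i in IH' *; set B := \prod_(i < n) b i in IH' *.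
have B1 : `|B| <= 1 by apply: prod_norm_le1 => i; rewrite b1 // leqW.
have -> : A * a n - B * b n = (A - B) * a n + B * (a n - b n) by ring.
apply: le_trans (ler_normD _ _) _; rewrite !normrM lerD //.
  by rewrite -[leRHS]mulr1; apply: ler_pM => //; exact: a1.
by rewrite -[leRHS]mul1r ler_pM.
Qed.

Lemma det_norm_le n (A : 'M[R]_n) : (forall i j, `|A i j| <= 1) -> `|\det A| <= n`!%:R.
Proof.
move=> A1; rewrite /determinant; apply: le_trans (ler_norm_sum _ _ _) _.
rewrite -card_Sn -sum1_card natr_sum.
apply: ler_sum => s _; rewrite normrM normrX normrN1 expr1n mul1r.
exact: prod_norm_le1.
Qed.

Lemma det_diff_le n (A B : 'M[R]_n) (h : R) :
  (forall i j, `|A i j| <= 1) -> (forall i j, `|B i j| <= 1) ->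
  (forall i j, `|A i j - B i j| <= h) ->
  `|\det A - \det B| <= n`!%:R * (n%:R * h).
Proof.
move=> A1 B1 AB; rewrite /determinant -sumrB; apply: le_trans (ler_norm_sum _ _ _) _.
rewrite -card_Sn -sum1_card natr_sum mulr_suml.
apply: ler_sum => s _; rewrite -mulrBr normrM normrX normrN1 expr1n mul1r.
case: n A B A1 B1 AB s => [|n] A B A1 B1 AB s; first by rewrite !big_ord0 subrr normr0 mul0r mulr0.
have := @prod_diff_le n.+1 (fun i => A (inord i) (s (inord i))) (fun i => B (inord i) (s (inord i))).
have E (C : 'M[R]_n.+1) : \prod_(i < n.+1) C (inord i) (s (inord i)) = \prod_i C i (s i).
  by apply: eq_bigr => i _; rewrite inord_val.
rewrite !E => H; apply: le_trans (H _ _) _ => // {H}.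
apply: le_trans (ler_sum _ (fun i _ => AB _ _)) _.
by rewrite sumr_const card_ord mul1r mulr_natl.
Qed.

Lemma adj_norm_le n (A : 'M[R]_n) k j : (forall i j, `|A i j| <= 1) -> `|\adj A k j| <= n`!%:R.
Proof.
move=> A1; rewrite mxE /cofactor normrM normrX normrN1 expr1n mul1r.
apply: le_trans (det_norm_le _) _; first by move=> ? ?; rewrite !mxE.
by rewrite ler_nat; apply: leq_fact => //; exact: leq_pred.
Qed.

Lemma adj_diff_le n (A B : 'M[R]_n) (h : R) k j :
  (forall i j, `|A i j| <= 1) -> (forall i j, `|B i j| <= 1) ->
  (forall i j, `|A i j - B i j| <= h) ->
  `|\adj A k j - \adj B k j| <= n`!%:R * (n%:R * h).
Proof.
move=> A1 B1 AB; rewrite !mxE /cofactor -mulrBr normrM normrX normrN1 expr1n mul1r.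
have h0 : 0 <= h by apply: le_trans (AB k j).
apply: le_trans (det_diff_le (h := h) _ _ _) _; try by move=> ? ?; rewrite !mxE.
apply: ler_pM; rewrite ?mulr_ge0 ?ler0n ?ler_nat ?leq_fact ?leq_pred //.
by apply: ler_wpM2r => //; rewrite ler_nat leq_pred.
Qed.

End ProductPerturbation.

(** * A regularised reciprocal for determinants that may vanish *)

Section RegularizedInverse.
Variable R : realFieldType.
Variable eta : R.
Hypothesis eta0 : 0 < eta.

(* A bounded Lipschitz substitute for 1/x. *)
Definition reginv (x : R) := x / (x ^+ 2 + eta ^+ 2).

Let den_gt0 x : 0 < x ^+ 2 + eta ^+ 2.
Proof. by rewrite ltr_wpDl ?sqr_ge0 // exprn_gt0. Qed.

Lemma reginv_norm_le x : `|reginv x| <= eta^-1.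
Proof.
rewrite normrM normfV (gtr0_norm (den_gt0 x)) ler_pdivrMr // mulrC.
rewrite ler_pdivlMr // -real_normK ?num_real //.
by have := sqr_ge0 (`|x| - eta); have := normr_ge0 x; nra.
Qed.

Lemma reginv_diff_le x y : `|reginv x - reginv y| <= `|x - y| / eta ^+ 2.
Proof.
have dx := den_gt0 x; have dy := den_gt0 y.
have -> : reginv x - reginv y =
    (x - y) * ((eta ^+ 2 - x * y) / ((x ^+ 2 + eta ^+ 2) * (y ^+ 2 + eta ^+ 2))).
  by rewrite /reginv; field; rewrite !gt_eqF.
rewrite normrM; apply: ler_wpM2l => //.
rewrite normrM normfV (gtr0_norm (mulr_gt0 dx dy)) ler_pdivrMr ?mulr_gt0 //.
rewrite [leRHS]mulrC ler_pdivlMr ?exprn_gt0 //.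
have e2 : 0 < eta ^+ 2 by rewrite exprn_gt0.
have : `|eta ^+ 2 - x * y| <= eta ^+ 2 + `|x * y|.
  by apply: le_trans (ler_normB _ _) _; rewrite ger0_norm // ltW.
move=> /ler_wpM2r => /(_ _ (ltW e2)) /le_trans; apply.
have : `|x * y| <= (x ^+ 2 + y ^+ 2).
  rewrite normrM -[x ^+ 2]real_normK ?num_real // -[y ^+ 2]real_normK ?num_real //.
  by have := sqr_ge0 (`|x| - `|y|); have := sqr_ge0 (`|x|); have := sqr_ge0 (`|y|); nra.
have := mulr_ge0 (sqr_ge0 x) (sqr_ge0 y).
by nra.
Qed.

Lemma mul_reginv_ge0 x : 0 <= reginv x * x.
Proof. by rewrite /reginv mulrAC -expr2 divr_ge0 ?sqr_ge0 // ltW. Qed.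

Lemma mul_reginv_le1 x : reginv x * x <= 1.
Proof. by rewrite /reginv mulrAC -expr2 ler_pdivrMr // mul1r lerDl sqr_ge0. Qed.

(** The defect equals eta^2 / (x^2 + eta^2), and eta <= theta |x| once |x| >= tau. *)
Lemma mul_reginv_close tau theta x : 0 < tau -> eta <= theta * tau -> tau <= `|x| ->
  `|1 - reginv x * x| <= theta ^+ 2.
Proof.
move=> tau0 eb tx.
have -> : 1 - reginv x * x = eta ^+ 2 / (x ^+ 2 + eta ^+ 2).
  by rewrite /reginv; field; rewrite gt_eqF.
rewrite ger0_norm; last by rewrite divr_ge0 ?sqr_ge0 // ltW.
rewrite ler_pdivrMr //.
have th : 0 < theta by rewrite -(pmulr_lgt0 _ tau0); apply: lt_le_trans eb.
apply: (@le_trans _ _ (theta ^+ 2 * x ^+ 2)).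
  rewrite -exprMn -[leRHS]real_normK ?num_real // normrM (gtr0_norm th).
  have H : eta <= theta * `|x| by apply: le_trans eb _; rewrite ler_wpM2l // ltW.
  by rewrite ler_pXn2r ?nnegrE ?mulr_ge0 ?normr_ge0 // ltW.
by rewrite ler_wpM2l ?sqr_ge0 // lerDl sqr_ge0.
Qed.

End RegularizedInverse.

(** * Orbits of rational rotations *)

Section Rotation.
Variables q P : nat.
Hypotheses (q0 : (0 < q)%N) (copP : coprime P q).

Definition orbn (i : nat) : nat := ((i * P) %% q)%N.

Lemma orbnDq i : orbn (q + i) = orbn i.
Proof. by rewrite /orbn mulnDl (mulnC q) modnMDl. Qed.

Lemma orbn_lt i : (orbn i < q)%N. Proof. by rewrite ltn_pmod. Qed.

Lemma orbn_gt0 i : (0 < i < q)%N -> (0 < orbn i)%N.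
Proof.
case/andP=> i0 iq; rewrite lt0n -/(dvdn q (i * P)) Gauss_dvdl; last by rewrite coprime_sym.
by apply/negP => /(dvdn_leq i0); rewrite leqNgt iq.
Qed.

(** Coprimality makes m -> (q - m) P mod q injective on q indices, hence onto. The index q - m is
    where row m of [omx] starts. *)
Lemma orbn_surj j : (j < q)%N -> exists2 m, (m < q)%N & orbn (q - m) = j.
Proof.
move=> jq.
have inj : injective (fun m : 'I_q => Ordinal (orbn_lt (q - m))).
  move=> m m' /(congr1 val) /= /eqP; rewrite /orbn.
  wlog le : m m' / (m <= m')%N => [H e|].
    by case: (leqP m m') => [/H|/ltnW /H]; [|move=> H'; apply/esym/H'; rewrite eq_sym]; exact.
  rewrite eqn_mod_dvd; last by rewrite leq_mul2r leq_sub2l ?orbT.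
  rewrite -mulnBl Gauss_dvdl; last by rewrite coprime_sym.
  move=> dv; apply/val_inj => /=; apply/eqP; rewrite eqn_leq le /= leqNgt.
  apply/negP => lt; have := dvdn_leq _ dv.
  have := ltn_ord m; have := ltn_ord m'; lia.
have [g _ gK] := injF_bij inj.
by exists (g (Ordinal jq)) => //; have /(congr1 val) := gK (Ordinal jq).
Qed.

End Rotation.

(** * Products along rational orbits, their matrix and its regularised solution *)

Section RationalOrbit.
Variables (R : realFieldType) (q P : nat).
Local Notation orbn := (orbn q P).
Hypotheses (q0 : (0 < q)%N) (copP : coprime P q).

(** For u in [0, 1), [opt u i] is the i-th point of the orbit of u/q under t -> {t + P/q}, and
    [oprod a k u] is the value at [opt u a] of the k-th iterate on 1 of the Bishop operator with
    angle P/q. *)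
Definition opt (u : R) (i : nat) : R := (u + (orbn i)%:R) / q%:R.
Definition oprod (a k : nat) (u : R) : R := \prod_(i < k) opt u (a + i)%N.
(* Row m starts at orbit index q - m, which makes omx 0 lower triangular. *)
Definition omx (u : R) : 'M[R]_q := \matrix_(m, k) oprod (q - m)%N k u.
(** Polynomial entries make the determinant a polynomial in u, to which the sublevel estimate
    applies. *)
Definition omxp : 'M[{poly R}]_q :=
  \matrix_(m, k) \prod_(i < k) (q%:R^-1 *: ('X + (orbn (q - m + i)%N)%:R%:P)).

Let qR0 : 0 < q%:R :> R. Proof. by rewrite ltr0n. Qed.

Lemma optDq u i : opt u (q + i)%N = opt u i.
Proof. by rewrite /opt orbnDq. Qed.

Lemma opt01 u i : 0 <= u <= 1 -> 0 <= opt u i <= 1.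
Proof.
case/andP=> u0 u1; rewrite /opt divr_ge0 ?addr_ge0 ?ler0n //=.
rewrite ler_pdivrMr // mul1r.
have : (orbn i).+1%:R <= q%:R :> R by rewrite ler_nat orbn_lt.
by rewrite -natr1 => ?; lra.
Qed.

Lemma oprod_norm_le1 a k u : 0 <= u <= 1 -> `|oprod a k u| <= 1.
Proof.
move=> u01; apply: prod_norm_le1 => i.
by have /andP[? ?] := opt01 (a + i) u01; rewrite ger0_norm.
Qed.

Lemma oprod_ge0 a k u : 0 <= u <= 1 -> 0 <= oprod a k u.
Proof.
by move=> u01; apply: prodr_ge0 => i _; have /andP[] := opt01 (a + i) u01.
Qed.

Lemma oprod_diff_le a k u v : (k <= q)%N -> 0 <= u <= 1 -> 0 <= v <= 1 ->
  `|oprod a k u - oprod a k v| <= `|u - v|.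
Proof.
move=> kq u01 v01.
apply: le_trans (prod_diff_le (a := fun i => opt u (a + i)) (b := fun i => opt v (a + i)) _ _) _.
- by move=> i _; have /andP[? ?] := opt01 (a + i) u01; rewrite ger0_norm.
- by move=> i _; have /andP[? ?] := opt01 (a + i) v01; rewrite ger0_norm.
rewrite (eq_bigr (fun=> `|u - v| / q%:R)) => [|i _]; last first.
  by rewrite /opt -mulrBl opprD addrACA subrr addr0 normrM normfV (ger0_norm (ltW qR0)).
rewrite sumr_const card_ord -[leRHS]mulr1 -mulrnAr; apply: ler_wpM2l => //.
by rewrite -mulr_natl ler_pdivrMr // mul1r ler_nat.
Qed.

Lemma oprodD a k l u : oprod a (k + l) u = oprod a k u * oprod (a + k) l u.
Proof.
rewrite /oprod big_split_ord /=; congr (_ * _).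
by apply: eq_bigr => i _; rewrite addnA.
Qed.

(** Moving the start by one trades the factor at index a for the equal factor at index q + a. If
    this factor is 0 it cannot be cancelled, but then both products contain it. *)
Lemma oprod_full a u : oprod a q u = oprod 0 q u.
Proof.
elim: a => // a IH; rewrite -IH.
have := oprodD a 1 q u; have := oprodD a q 1 u.
rewrite (addnC q 1) => -> /esym; rewrite mulrC addn1.
rewrite /oprod !big_ord1 !addn0 (addnC a q) optDq.
set y := opt u a; set A := \prod_(i < q) opt u (a.+1 + i).
have [y0|y0] := eqVneq y 0.
  move=> _; have H b : (exists2 i : 'I_q, (b + i)%N = (q + a)%N \/ (b + i)%N = a & True) -> \prod_(i < q) opt u (b + i) = 0.
    by case=> i hi _; rewrite (bigD1 i) //=; case: hi => ->; rewrite ?optDq -/y y0 mul0r.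
  rewrite /A !H //.
    by exists (Ordinal q0) => //=; right; rewrite addn0.
  have l : (q.-1 < q)%N by rewrite prednK.
  by exists (Ordinal l) => //=; left; rewrite addSnnS prednK // addnC.
by move=> /(mulIf y0).
Qed.

Lemma oprod_iter a n k u : oprod a (n * q + k) u = oprod 0 q u ^+ n * oprod a k u.
Proof.
elim: n a => [|n IH] a; first by rewrite mul0n add0n expr0 mul1r.
rewrite mulSn -addnA oprodD oprod_full IH exprS -mulrA; congr (_ * (_ * _)).
by apply: eq_bigr => i _; rewrite (addnC a q) -addnA optDq.
Qed.

(** Write w(u) as u/q times the factors of index 1, ..., q-1. By coprimality these points avoid the
    cell of 0, so each factor is at least 1/q, and each increases with u. *)
Lemma oprod_full_expand (u v : R) : 0 <= v -> v <= u -> u <= 1 ->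
  (u - v) <= q%:R ^+ q * (oprod 0 q u - oprod 0 q v).
Proof.
move=> v0 vu u1.
have [k qk] : exists k, q = k.+1 by exists q.-1; rewrite prednK.
have E w : oprod 0 q w = w / q%:R * \prod_(i < k) opt w i.+1.
  rewrite /oprod -(big_mkord xpredT (fun i => opt w (0 + i))) [X in index_iota 0 X]qk.
  rewrite big_mkord big_ord_recl /= {1}/opt {1}/orbn mul0n mod0n addr0.
  by congr (_ * _); apply: eq_bigr => i _.
have le1 : \prod_(i < k) opt v i.+1 <= \prod_(i < k) opt u i.+1.
  apply: ler_prod => i _; rewrite divr_ge0 ?addr_ge0 ?ler0n //=.
  by rewrite ler_wpM2r ?invr_ge0 ?ler0n // lerD2r.
have le2 : (q%:R ^+ k)^-1 <= \prod_(i < k) opt u i.+1.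
  rewrite -exprVn -[in leLHS](card_ord k) -prodr_const.
  apply: ler_prod => i _; rewrite invr_ge0 ler0n /= /opt ler_peMl ?invr_ge0 ?ler0n //.
  have : (1 <= orbn i.+1)%N by apply: (orbn_gt0 copP); rewrite /= qk ltnS.
  by rewrite -(ler_nat R) => ?; lra.
rewrite !E [X in _ ^+ X]qk exprS.
set A := \prod_(i < k) _ in le1 *; set B := \prod_(i < k) _ in le1 le2 *.
have -> : q%:R * q%:R ^+ k * (u / q%:R * B - v / q%:R * A) = q%:R ^+ k * (u * B - v * A).
  by field; rewrite gt_eqF.
have qk0 : 0 < q%:R ^+ k :> R by rewrite exprn_gt0.
rewrite -ler_pdivrMl //; apply: (@le_trans _ _ ((u - v) * B)).
  by rewrite mulrC ler_wpM2l // subr_ge0.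
by rewrite mulrBl lerD2l lerN2 ler_wpM2l.
Qed.

Lemma oprod_full_inv_lip (u v : R) : 0 <= u <= 1 -> 0 <= v <= 1 ->
  `|u - v| <= q%:R ^+ q * `|oprod 0 q u - oprod 0 q v|.
Proof.
wlog vu : u v / v <= u => [H u01 v01|].
  case/orP: (le_total v u) => [/H|/H /(_ v01 u01)]; first exact.
  by rewrite (distrC v) (distrC (oprod _ _ v)).
move=> /andP[u0 u1] /andP[v0 v1]; rewrite ger0_norm ?subr_ge0 //.
apply: le_trans (oprod_full_expand v0 vu u1) _.
by rewrite ler_wpM2l ?exprn_ge0 ?ler0n // ler_norm.
Qed.

Lemma horner_omxp_det u : (\det omxp).[u] = \det (omx u).
Proof.
rewrite -[LHS]/(horner_eval u (\det omxp)) -det_map_mx; congr (\det _).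
apply/matrixP => m k; rewrite !mxE /= /horner_eval horner_prod.
by apply: eq_bigr => i _; rewrite !hornerE /opt mulrC.
Qed.

Lemma size_prod_affine k (c d : nat -> R) :
  (size (\prod_(i < k) (c i *: ('X + (d i)%:P)))%R <= k.+1)%N.
Proof.
elim: k => [|k IH]; first by rewrite big_ord0 size_poly1.
rewrite big_ord_recr /=; apply: leq_trans (size_polyMleq _ _) _.
have : (size (c k *: ('X + (d k)%:P)) <= 2)%N.
  by apply: leq_trans (size_scale_leq _ _) _; rewrite size_XaddC.
by move: IH; set x := size _; set y := size _; lia.
Qed.

(** Entries have degree at most q - 1, so every product in the Leibniz sum has degree below q^2. The
    rounded value q^2 is the degree bound fed to [few_small_intervals]. *)
Lemma size_det_omxp : (size (\det omxp) <= (q * q).+1)%N.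
Proof.
rewrite /determinant; apply: leq_trans (size_sum _ _ _) _.
apply/bigmax_leqP => s _; rewrite mulr_sign.
have H : (size (\prod_i omxp i (s i))%R <= (q * q).+1)%N.
  have E i : (size (omxp i (s i)) <= q.+1)%N.
    rewrite mxE; apply: leq_trans (size_prod_affine _ (fun=> q%:R^-1) (fun j => (orbn (q - i + j))%:R)) _.
    by rewrite ltnS ltnW.
  apply: leq_trans (size_poly_prod_leq _ _) _; rewrite /=.
  apply: (@leq_trans ((\sum_(i < q) q.+1).+1 - #|'I_q|)%N).
    by apply: leq_sub2r; rewrite ltnS; apply: leq_sum.
  by rewrite sum_nat_const card_ord; lia.
by case: (odd_perm s); rewrite ?size_polyN.
Qed.

(** At u = 0 the orbit point of index q is 0. Row m starts at index q - m, so its entries in columns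
    beyond m contain that point and vanish. The m-th diagonal entry has m factors, each at least
    1/q. *)
Lemma det_omx0 : (q%:R ^+ 'C(q, 2))^-1 <= \det (omx 0).
Proof.
rewrite det_trig; last first.
  apply/is_trig_mxP => m k mk; rewrite mxE /oprod (bigD1 (Ordinal mk)) //=.
  by rewrite subnK ?(ltnW (ltn_ord m)) // -[X in opt _ X]addn0 optDq /opt /orbn mul0n mod0n addr0 mul0r mul0r.
have -> : 'C(q, 2) = (\sum_(m < q) m)%N.
  by rewrite -bin2_sum big_mkord.
rewrite -exprVn -prodrXr; apply: ler_prod => m _.
rewrite exprn_ge0 ?invr_ge0 ?ler0n //= mxE /oprod.
rewrite -[X in _ ^+ X](card_ord (nat_of_ord m)) -prodr_const; apply: ler_prod => i _.
rewrite invr_ge0 ler0n /= /opt add0r ler_peMl ?invr_ge0 ?ler0n //.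
rewrite ler1n; apply: (orbn_gt0 copP).
have := ltn_ord i; have := ltn_ord m; lia.
Qed.

Lemma omx_norm_le1 u i j : 0 <= u <= 1 -> `|omx u i j| <= 1.
Proof. by move=> u01; rewrite mxE oprod_norm_le1. Qed.

Lemma omx_diff_le u v i j : 0 <= u <= 1 -> 0 <= v <= 1 ->
  `|omx u i j - omx v i j| <= `|u - v|.
Proof. by move=> u01 v01; rewrite !mxE oprod_diff_le // ltnW. Qed.

Section Coefficients.
Variables (eta B : R) (G : 'I_q -> R).
Hypotheses (eta0 : 0 < eta) (eta1 : eta <= 1) (B0 : 0 <= B) (GB : forall j, `|G j| <= B).

(** Cramer's rule with [reginv eta] in place of the reciprocal of the determinant: multiplied back
    by the matrix, it returns G times a scalar in [0, 1]. *)
Definition ocoef (k : 'I_q) (u : R) : R :=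
  reginv eta (\det (omx u)) * \sum_j \adj (omx u) k j * G j.

Lemma ocoef_solve (m : 'I_q) u :
  \sum_k ocoef k u * oprod (q - m) k u
  = reginv eta (\det (omx u)) * \det (omx u) * G m.
Proof.
pose g : 'cV[R]_q := \col_j G j.
have : omx u *m (\adj (omx u) *m g) = \det (omx u) *: g.
  by rewrite mulmxA mul_mx_adj mul_scalar_mx.
move=> /matrixP /(_ m 0); rewrite !mxE => E.
rewrite -mulrA -E big_distrr /=; apply: eq_bigr => k _.
rewrite /ocoef -mulrA; congr (_ * _); rewrite !mxE mulrC; congr (_ * _).
by apply: eq_bigr => j _; rewrite [g _ _]mxE.
Qed.

Lemma ocoef_norm_le k u : 0 <= u <= 1 ->
  `|ocoef k u| <= eta^-1 * (q%:R * (q`!%:R * B)).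
Proof.
move=> u01; rewrite normrM; apply: ler_pM => //; first exact: reginv_norm_le.
apply: le_trans (ler_norm_sum _ _ _) _.
apply: le_trans (_ : \sum_(j < q) (q`!%:R * B) <= _); last first.
  by rewrite sumr_const card_ord -[leLHS]mulr_natl.
apply: ler_sum => j _; rewrite normrM ler_pM //; apply: adj_norm_le => i l; exact: omx_norm_le1.
Qed.

(** Product rule: varying the scalar costs eta^-2, varying the adjugate costs eta^-1, and eta <= 1
    merges the two. *)
Lemma ocoef_diff_le k u v : 0 <= u <= 1 -> 0 <= v <= 1 ->
  `|ocoef k u - ocoef k v| <= 2 * B * (q%:R * q`!%:R) ^+ 2 / eta ^+ 2 * `|u - v|.
Proof.
move=> u01 v01; rewrite /ocoef.
set a := reginv eta _; set b := reginv eta _.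
set S := \sum_j _; set T := \sum_j _.
have q1 : 1 <= q%:R :> R by rewrite ler1n.
have f1 : 1 <= q`!%:R :> R by rewrite ler1n fact_gt0.
have -> : a * S - b * T = (a - b) * S + b * (S - T) by ring.
have h0 : 0 <= `|u - v| by [].
have ei0 : 0 < eta^-1 by rewrite invr_gt0.
have ei1 : 1 <= eta^-1 by rewrite -invr1 lef_pV2 ?posrE.
have ab : `|a - b| <= q`!%:R * (q%:R * `|u - v|) * (eta^-1) ^+ 2.
  apply: le_trans (reginv_diff_le eta0 _ _) _; rewrite -exprVn; apply: ler_wpM2r.
    by rewrite exprn_ge0 // ltW.
  by apply: det_diff_le => *; rewrite ?omx_norm_le1 ?omx_diff_le.
have bb : `|b| <= eta^-1 by exact: reginv_norm_le.
have SB : `|S| <= q%:R * (q`!%:R * B).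
  apply: le_trans (ler_norm_sum _ _ _) _.
  apply: le_trans (_ : \sum_(j < q) (q`!%:R * B) <= _); last first.
    by rewrite sumr_const card_ord -[leLHS]mulr_natl.
  apply: ler_sum => j _; rewrite normrM ler_pM //; apply: adj_norm_le => i l; exact: omx_norm_le1.
have ST : `|S - T| <= q%:R * (q`!%:R * (q%:R * `|u - v|) * B).
  rewrite -sumrB; apply: le_trans (ler_norm_sum _ _ _) _.
  apply: le_trans (_ : \sum_(j < q) (q`!%:R * (q%:R * `|u - v|) * B) <= _); last first.
    by rewrite sumr_const card_ord -[leLHS]mulr_natl.
  apply: ler_sum => j _; rewrite -mulrBl normrM ler_pM //.
  by apply: adj_diff_le => *; rewrite ?omx_norm_le1 ?omx_diff_le.
apply: le_trans (ler_normD _ _) _; rewrite (normrM (a - b)) (normrM b).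
apply: le_trans (lerD (ler_pM _ _ ab SB) (ler_pM _ _ bb ST)) _ => //.
rewrite -exprVn; move: (eta^-1) ei0 ei1 => e e0 e1.
set h := `|u - v| in h0 *; set n := q%:R in q1 *; set f := q`!%:R in f1 *.
have K0 : 0 <= n ^+ 2 * f ^+ 1 * h * B * e by rewrite !mulr_ge0 ?exprn_ge0 //; lra.
have -> : f * (n * h) * e ^+ 2 * (n * (f * B)) + e * (n * (f * (n * h) * B))
  = n ^+ 2 * f ^+ 1 * h * B * e * (e * f + 1) by ring.
have -> : 2 * B * (n * f) ^+ 2 * e ^+ 2 * h = n ^+ 2 * f ^+ 1 * h * B * e * (2 * e * f) by ring.
apply: ler_wpM2l => //; have := mulr_ege1 e1 f1; lra.
Qed.

End Coefficients.
End RationalOrbit.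

(** * Bernstein approximation *)

Section Bernstein.
Variable R : realFieldType.

(* The Bernstein polynomial of degree N with node values f 0, ..., f N; Pascal's
   recursion keeps binomial coefficients out of the estimates. *)
Fixpoint bern (N : nat) (f : nat -> R) : {poly R} :=
  if N is n.+1 then (1 - 'X) * bern n f + 'X * bern n (f \o succn)
  else (f 0%N)%:P.

Lemma size_bern N f : (size (bern N f) <= N.+1)%N.
Proof.
elim: N f => [|N IH] f /=; first exact: size_polyC_leq1.
apply: leq_trans (size_polyD _ _) _; rewrite geq_max.
have s1X : (size (1 - 'X : {poly R})%R <= 2)%N.
  by apply: leq_trans (size_polyD _ _) _; rewrite size_polyN size_polyX size_poly1.
apply/andP; split; apply: leq_trans (size_polyMleq _ _) _.
  by have := IH f; move: s1X; set x := size _; set y := size _; lia.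
by rewrite size_polyX /= ltnS IH.
Qed.

(** The l^1 norm of the coefficients. It multiplies the error of a single iterate when the rational
    angle is replaced by alpha. *)
Definition coefsum (p : {poly R}) := \sum_(i < size p) `|p`_i|.

Lemma coefsumE d (p : {poly R}) : (size p <= d)%N -> \sum_(i < d) `|p`_i| = coefsum p.
Proof.
move=> sp; rewrite /coefsum -!(big_mkord xpredT (fun i => `|p`_i|)).
rewrite (big_cat_nat _ (n := size p)) //= [X in _ + X]big_nat_cond [X in _ + X]big1 ?addr0 // => i.
by rewrite andbT => /andP[? _]; rewrite nth_default ?normr0.
Qed.

Lemma coefsumD (p r : {poly R}) : coefsum (p + r) <= coefsum p + coefsum r.
Proof.
set d := maxn (size p) (size r).
rewrite -(@coefsumE d (p + r)) ?size_polyD // -(@coefsumE d p) ?leq_maxl //.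
rewrite -(@coefsumE d r) ?leq_maxr // -big_split /=.
by apply: ler_sum => i _; rewrite coefD ler_normD.
Qed.

Lemma coefsumN (p : {poly R}) : coefsum (- p) = coefsum p.
Proof. by rewrite /coefsum size_polyN; apply: eq_bigr => i _; rewrite coefN normrN. Qed.

Lemma coefsumXM (p : {poly R}) : coefsum ('X * p) <= coefsum p.
Proof.
rewrite -(@coefsumE (size p).+1 ('X * p)); last first.
  by apply: leq_trans (size_polyMleq _ _) _; rewrite size_polyX.
rewrite big_ord_recl coefXM eqxx normr0 add0r.
by apply: ler_sum => i _; rewrite coefXM.
Qed.

(** The recursion (1 - X) A + X B = A - X A + X B has three terms, and multiplication by X does not
    increase the norm; hence a factor 3 per step. *)
Lemma coefsum_bern N f H : (forall m, (m <= N)%N -> `|f m| <= H) ->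
  coefsum (bern N f) <= 3 ^+ N * H.
Proof.
elim: N f => [|N IH] f fH /=.
  rewrite -(@coefsumE 1) ?size_polyC_leq1 // big_ord1 coefC eqxx expr0 mul1r.
  exact: fH.
apply: le_trans (coefsumD _ _) _.
have h1 := IH f (fun m h => fH m (leqW h)).
have h2 := IH (f \o succn) (fun m h => fH m.+1 h).
apply: le_trans (lerD _ (coefsumXM _)) _; first exact: lexx.
rewrite mulrBl mul1r; apply: le_trans (lerD (coefsumD _ _) (lexx _)) _.
rewrite coefsumN; have := coefsumXM (bern N f); rewrite exprS.
by move: h1 h2; rewrite -mulrA; move: (3 ^+ N * H) => z; lra.
Qed.

(** The bracket is the second moment about y of a binomial variable with parameters N and x. The
    induction conditions on one trial: a success moves y to y - 1, so y must be general. *)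
Lemma bern_error N f (c a b y x : R) : 0 <= x <= 1 ->
  (forall m, (m <= N)%N -> `|f m - c| <= a + b * (m%:R - y) ^+ 2) ->
  `|(bern N f).[x] - c| <= a + b * ((N%:R * x - y) ^+ 2 + N%:R * (x * (1 - x))).
Proof.
case/andP=> x0 x1; elim: N f y => [|N IH] f y fc /=.
  by rewrite hornerC; apply: le_trans (fc 0%N _) _ => //; rewrite !mul0r addr0.
have h1 := IH f y (fun m h => fc m (leqW h)).
have h2 : `|(bern N (f \o succn)).[x] - c| <=
    a + b * ((N%:R * x - (y - 1)) ^+ 2 + N%:R * (x * (1 - x))).
  apply: IH => m mN; apply: le_trans (fc m.+1 mN) _.
  by rewrite -natr1 (_ : m%:R - (y - 1) = m%:R + 1 - y) //; ring.
set rhs := (X in _ <= X); rewrite !hornerE; set A := _.[x] in h1 *; set A' := _.[x] in h2 *.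
have -> : (1 - x) * A + x * A' - c = (1 - x) * (A - c) + x * (A' - c) by ring.
apply: le_trans (ler_normD _ _) _; rewrite !normrM (ger0_norm x0) ger0_norm ?subr_ge0 //.
have x1' : 0 <= 1 - x by rewrite subr_ge0.
apply: le_trans (lerD (ler_wpM2l x1' h1) (ler_wpM2l x0 h2)) _.
by rewrite /rhs -natr1 le_eqVlt; apply/orP; left; apply/eqP; ring.
Qed.

End Bernstein.

Section BernsteinLipschitz.
Variable R : realFieldType.

(** In the variable w(u) the function c is Lipschitz with constant L M. The inequality z <= theta +
    z^2 / (4 theta) turns this into the quadratic hypothesis of [bern_error], whose variance term
    yields the 1/N. The points supplied by the second assumption serve as preimages of the nodes
    m/N, including nodes outside the range of w. *)
Lemma bern_lipschitz (w c : R -> R) (N : nat) (L H M theta : R) :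
  (0 < N)%N -> 0 < theta -> 0 <= L -> 0 <= M ->
  (forall u : R, 0 <= u <= 1 -> 0 <= w u <= 1) ->
  (forall y, 0 <= y <= 1 -> exists2 u, 0 <= u <= 1 &
     forall v, 0 <= v <= 1 -> `|u - v| <= M * `|y - w v|) ->
  (forall u v, 0 <= u <= 1 -> 0 <= v <= 1 -> `|c u - c v| <= L * `|u - v|) ->
  (forall u : R, 0 <= u <= 1 -> `|c u| <= H) ->
  exists P : {poly R}, [/\ (size P <= N.+1)%N, coefsum P <= 3 ^+ N * H &
    forall u, 0 <= u <= 1 -> `|P.[w u] - c u| <= theta + (L * M) ^+ 2 / (4 * theta * N%:R)].
Proof.
move=> N0 th0 L0 M0 w01 wsurj cL cH.
have NR0 : 0 < N%:R :> R by rewrite ltr0n.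
have /choice[s sP] : forall m : nat, exists u : R, (m <= N)%N -> 0 <= u <= 1 /\
     forall v, 0 <= v <= 1 -> `|u - v| <= M * `|m%:R / N%:R - w v|.
  move=> m; case: (leqP m N) => [mN|_]; last by exists 0.
  have [|u u01 uP] := wsurj (m%:R / N%:R); last by exists u.
  by rewrite divr_ge0 //= ler_pdivrMr // mul1r ler_nat.
exists (bern N (c \o s)); split.
- exact: size_bern.
- by apply: coefsum_bern => m /sP[? _]; exact: cH.
move=> u u01; have /andP[wu0 wu1] := w01 u u01.
set K := L * M; set b := K ^+ 2 / (4 * theta) / N%:R ^+ 2.
have K0 : 0 <= K by rewrite mulr_ge0.
have b0 : 0 <= b by rewrite !divr_ge0 ?exprn_ge0 ?mulr_ge0 // ltW.
apply: le_trans (bern_error (a := theta) (b := b) (y := N%:R * w u) _ _) _.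
- exact: w01.
- move=> m mN; have [sm01 sm] := sP m mN.
  apply: le_trans (cL _ _ sm01 u01) _.
  apply: (@le_trans _ _ (K * `|m%:R / N%:R - w u|)).
    by rewrite /K -mulrA ler_wpM2l // sm.
  rewrite (_ : b * _ = (K * `|m%:R / N%:R - w u|) ^+ 2 / (4 * theta)); last first.
    rewrite exprMn real_normK ?num_real // /b; field.
    by rewrite !gt_eqF.
  set z := K * _.
  rewrite -subr_ge0 (_ : _ - z = (2 * theta - z) ^+ 2 / (4 * theta)).
    by rewrite divr_ge0 ?sqr_ge0 // mulr_ge0 // ltW.
  by field; rewrite gt_eqF.
- rewrite subrr expr0n /= add0r lerD2l.
  rewrite (_ : b * _ = K ^+ 2 / (4 * theta * N%:R) * (w u * (1 - w u))); last first.
    by rewrite /b; field; rewrite !gt_eqF.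
  rewrite -[leRHS]mulr1; apply: ler_wpM2l.
    by rewrite divr_ge0 ?exprn_ge0 // !mulr_ge0 // ltW.
  by nra.
Qed.

End BernsteinLipschitz.

(** w maps [0, 1] onto [0, w(1)], but the Bernstein nodes fill [0, 1]. For y above w(1) the choice u
    = 1 works, since w(v) <= w(1) < y. *)
Lemma oprod_full_clip (R : rcfType) (q P : nat) (y : R) :
  (0 < q)%N -> coprime P q -> 0 <= y <= 1 ->
  exists2 u, 0 <= u <= 1 &
    forall v, 0 <= v <= 1 -> `|u - v| <= q%:R ^+ q * `|y - oprod q P 0 q v|.
Proof.
move=> q0 copP /andP[y0 y1].
pose W : {poly R} := \prod_(i < q) (q%:R^-1 *: ('X + (orbn q P (0 + i)%N)%:R%:P)).
have WE u : W.[u] = oprod q P 0 q u.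
  rewrite horner_prod; apply: eq_bigr => i _.
  by rewrite !hornerE /opt mulrC.
have b01 : 0 <= (0 : R) <= 1 by rewrite lexx ler01.
have b11 : 0 <= (1 : R) <= 1 by rewrite lexx ler01.
have W0 : W.[0] = 0.
  rewrite WE /oprod (bigD1 (Ordinal q0)) //=.
  by rewrite /opt /orbn !mul0n mod0n addr0 mul0r mul0r.
have [yW|Wy] := leP y W.[1].
  have [||u /andP[u0 u1]] := @poly_ivt _ (W - y%:P) 0 1.
  - exact: ler01.
  - by rewrite !hornerE W0; apply/andP; split; lra.
  rewrite rootE !hornerE => /eqP Wu; exists u; first by rewrite u0.
  move=> v v01; rewrite (_ : y = oprod q P 0 q u); last by rewrite -WE; lra.
  by apply: oprod_full_inv_lip => //; rewrite u0.
exists 1 => // v v01.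
apply: le_trans (oprod_full_inv_lip q0 copP b11 v01) _.
rewrite ler_wpM2l ?exprn_ge0 ?ler0n // -!WE.
have le : W.[v] <= W.[1].
  have /andP[v0 v1] := v01.
  have := oprod_full_expand q0 copP v0 v1 (lexx _); rewrite -!WE => H.
  have : 0 <= q%:R ^+ q * (W.[1] - W.[v]) by apply: le_trans H; rewrite subr_ge0.
  by rewrite pmulr_rge0 ?subr_ge0 // exprn_gt0 // ltr0n.
have le' : W.[v] <= y by apply: le_trans le _; exact: ltW.
by rewrite !ger0_norm ?subr_ge0 // lerD2r ltW.
Qed.

(** * Bishop operators with nearly rational angle *)

(** [a k n] is the n-th coefficient of the Bernstein polynomial for the k-th regularised
    coefficient. Up to the error [err] the combination gives G m times [reginv] of the determinant
    times the determinant; this scalar always lies in [0, 1], and it is within theta^2 of 1 where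
    the determinant is at least tau in absolute value. *)
Lemma rational_approximant (R : rcfType) (q P N : nat) (tau theta theta1 B : R) (G : 'I_q -> R) :
  (0 < q)%N -> coprime P q -> (0 < N)%N -> 0 < tau -> tau <= 1 ->
  0 < theta -> theta <= 1 -> 0 < theta1 -> 0 <= B ->
  (forall j, `|G j| <= B) ->
  let eta := theta * tau in
  let L := 2 * B * (q%:R * q`!%:R) ^+ 2 / eta ^+ 2 * q%:R ^+ q in
  exists a : nat -> nat -> R,
    \sum_(k < q) \sum_(n < N.+1) `|a k n| <= q%:R * (3 ^+ N * (eta^-1 * (q%:R * (q`!%:R * B)))) /\
    forall (m : 'I_q) (u : R), 0 <= u <= 1 ->
      let err := q%:R * (theta1 + L ^+ 2 / (4 * theta1 * N%:R)) in
      let A := \sum_(k < q) \sum_(n < N.+1) a k n * oprod q P (q - m) (n * q + k) u in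
      `|A - G m| <= err + B /\
      (tau <= `|\det (omx q P u)| -> `|A - G m| <= err + B * theta ^+ 2).
Proof.
move=> q0 copP N0 tau0 tau1 th0 th1 th10 B0 GB eta L.
have eta0 : 0 < eta by rewrite mulr_gt0.
have eta1 : eta <= 1 by rewrite /eta -[leRHS]mulr1 ler_pM // ltW.
set H := eta^-1 * _.
set L0 := 2 * B * (q%:R * q`!%:R) ^+ 2 / eta ^+ 2.
have L00 : 0 <= L0 by rewrite divr_ge0 ?mulr_ge0 ?exprn_ge0 ?mulr_ge0 // ltW.
have /choice[Q QP] : forall k : 'I_q, exists Q : {poly R},
    [/\ (size Q <= N.+1)%N, coefsum Q <= 3 ^+ N * H &
    forall u, 0 <= u <= 1 -> `|Q.[oprod q P 0 q u] - ocoef P eta G k u| <=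
      theta1 + L ^+ 2 / (4 * theta1 * N%:R)].
  move=> k; apply: (@bern_lipschitz _ (oprod q P 0 q) _ N L0 H (q%:R ^+ q)) => //.
  - move=> u u01; rewrite oprod_ge0 //=.
    by have := oprod_norm_le1 P q0 0 q u01; rewrite ger0_norm ?oprod_ge0.
  - by move=> y y01; exact: oprod_full_clip.
  - by move=> u v u01 v01; exact: ocoef_diff_le.
  - by move=> u u01; exact: ocoef_norm_le.
pose a k n := if insub k is Some k' then (Q k')`_n else 0.
have aE (k : 'I_q) n : a k n = (Q k)`_n by rewrite /a valK.
exists a; split.
  apply: le_trans (_ : \sum_(k < q) 3 ^+ N * H <= _); last first.
    by rewrite sumr_const card_ord -[leLHS]mulr_natl.
  apply: ler_sum => k _; have [sQ cQ _] := QP k.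
  rewrite (eq_bigr (fun n : 'I_N.+1 => `|(Q k)`_n|)) => [|n _]; last by rewrite aE.
  by rewrite coefsumE.
move=> m u u01 err A.
have AE : A = \sum_(k < q) (Q k).[oprod q P 0 q u] * oprod q P (q - m) k u.
  apply: eq_bigr => k _; have [sQ _ _] := QP k.
  rewrite (horner_coef_wide _ sQ) mulr_suml; apply: eq_bigr => n _.
  by rewrite aE oprod_iter // mulrA.
have solve := ocoef_solve P eta G m u.
set D := \det _ in solve *; set r := reginv eta D in solve *.
have main : `|A - r * D * G m| <= err.
  rewrite -solve AE -sumrB; apply: le_trans (ler_norm_sum _ _ _) _.
  apply: le_trans (_ : \sum_(k < q) (theta1 + L ^+ 2 / (4 * theta1 * N%:R)) <= _); last first.
    by rewrite sumr_const card_ord -[leLHS]mulr_natl.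
  apply: ler_sum => k _; rewrite -mulrBl normrM -[leRHS]mulr1; apply: ler_pM => //.
    by have [_ _] := QP k; apply.
  exact: oprod_norm_le1.
have split1 x : `|1 - r * D| <= x -> `|A - G m| <= err + B * x.
  move=> hx; rewrite (_ : A - G m = (A - r * D * G m) - (1 - r * D) * G m); last by ring.
  apply: le_trans (ler_normB _ _) _; apply: lerD => //.
  by rewrite normrM mulrC ler_pM.
split => [|tD].
  rewrite -[X in err + X]mulr1; apply: split1.
  rewrite ger0_norm ?subr_ge0; last exact: mul_reginv_le1.
  by rewrite lerBlDl lerDr mul_reginv_ge0.
by apply: split1; apply: mul_reginv_close tD => //; rewrite /eta.
Qed.

(** * Iterates of the Bishop operator on the function 1, and their stability in the angle *)

Section FractionalOrbit.
Variable R : realType.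
Implicit Types (alpha t x : R).

Lemma fracpart01 x : 0 <= fracpart x < 1.
Proof.
have := floorD1_gt x; have := floor_le x; rewrite intrD /fracpart => ? ?.
by apply/andP; split; lra.
Qed.

Lemma fracpart_eq x y (k : int) : 0 <= y < 1 -> x = y + k%:~R -> fracpart x = y.
Proof.
move=> /andP[y0 y1] ->; rewrite /fracpart (_ : Num.floor _ = k) ?addrK //.
by apply/floor_def; rewrite intrD; apply/andP; split; lra.
Qed.

Lemma fracpart_id x : 0 <= x < 1 -> fracpart x = x.
Proof. by move=> x01; apply: (@fracpart_eq _ _ 0) => //; rewrite addr0. Qed.

(** These iterates are real-valued, so the approximation is carried out over [R]; complex
    coefficients enter only at the end. *)
Fixpoint bis alpha (n : nat) (t : R) : R :=
  if n is k.+1 then t * bis alpha k (fracpart (t + alpha)) else 1.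

Lemma iter_bishop_bis alpha n t :
  iter n (bishop alpha) (fun=> 1) t = (bis alpha n t)%:C%C.
Proof. by elim: n t => // n IH t; rewrite iterS /bishop /= -/(bishop alpha) IH rmorphM. Qed.

Lemma bis01 alpha n t : 0 <= t <= 1 -> 0 <= bis alpha n t <= 1.
Proof.
elim: n t => [|n IH] t t01 /=; first by rewrite ler01 lexx.
have /andP[f0 f1] := fracpart01 (t + alpha).
have /IH/andP[b0 b1] : 0 <= fracpart (t + alpha) <= 1 by rewrite f0 ltW.
case/andP: t01 => t0 t1.
by rewrite mulr_ge0 //= -[leRHS]mulr1 ler_pM.
Qed.

Lemma bis_prod alpha n t : 0 <= t < 1 ->
  bis alpha n t = \prod_(i < n) fracpart (t + i%:R * alpha).
Proof.
elim: n t => [|n IH] t t01; first by rewrite big_ord0.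
rewrite big_ord_recl mul0r addr0 fracpart_id //= IH ?fracpart01 //; congr (_ * _).
apply: eq_bigr => i _; set z := t + alpha.
apply: (@fracpart_eq _ _ (Num.floor (t + (lift ord0 i)%:R * alpha) - Num.floor z)).
  exact: fracpart01.
by rewrite /fracpart /z lift0 -natr1 intrD intrN; ring.
Qed.

(** The margin for u keeps the whole rational orbit more than h = d delta away from 0 and 1, while
    at most d steps of angle alpha drift by at most h. Both orbits therefore wrap at the same steps,
    and each factor changes by at most h. *)
Lemma bis_near_rational alpha (q P d n a : nat) (delta u : R) :
  (0 < q)%N -> `|alpha - P%:R / q%:R| <= delta -> (n <= d)%N ->
  q%:R * (d%:R * delta) < u -> u < 1 - q%:R * (d%:R * delta) ->
  `|bis alpha n (opt q P u a) - oprod q P a n u| <= n%:R * (d%:R * delta).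
Proof.
move=> q0 da nd u0 u1.
have qR0 : 0 < q%:R :> R by rewrite ltr0n.
set h := d%:R * delta in u0 u1 *.
have dl0 : 0 <= delta by apply: le_trans da.
have h0 : 0 <= h by rewrite mulr_ge0.
have uh : h < u / q%:R by rewrite ltr_pdivlMr // mulrC.
have ub : u / q%:R < 1 / q%:R - h.
  by rewrite ltrBrDr -(ltr_pM2r qR0) mulrDl !divfK ?gt_eqF //; lra.
have yb i : h < opt q P u i < 1 - h.
  rewrite /opt mulrDl; apply/andP; split.
    by apply: lt_le_trans uh _; rewrite lerDl divr_ge0.
  have : (orbn q P i).+1%:R / q%:R <= 1 :> R.
    by rewrite ler_pdivrMr // mul1r ler_nat orbn_lt.
  by rewrite -natr1 mulrDl; lra.
rewrite bis_prod; last by have /andP[? ?] := yb a; apply/andP; split; lra.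
have e i : (i < n)%N -> fracpart (opt q P u a + i%:R * alpha) =
     opt q P u (a + i) + i%:R * (alpha - P%:R / q%:R).
  move=> ilt; apply: (@fracpart_eq _ _ ((orbn q P a + i * P) %/ q)%N).
    have /andP[? ?] := yb (a + i)%N.
    have : `|i%:R * (alpha - P%:R / q%:R)| <= h.
      rewrite normrM ler_pM // ger0_norm // ler_nat.
      by apply: leq_trans nd; exact: ltnW.
    by rewrite ler_norml => /andP[? ?]; apply/andP; split; lra.
  have E : (orbn q P a + i * P = (orbn q P a + i * P) %/ q * q + orbn q P (a + i))%N.
    by rewrite {1}(divn_eq (orbn q P a + i * P) q) /orbn modnDml -mulnDl.
  have := congr1 (fun n => n%:R : R) E; rewrite !natrD !natrM => E'.
  rewrite /opt -pmulrn; apply: (mulIf (lt0r_neq0 qR0)).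
  rewrite !mulrDl !mulrBr !mulrBl !divfK ?gt_eqF // -!mulrA !mulVf ?gt_eqF // !mulr1.
  lra.
apply: le_trans (prod_diff_le (a := fun i => fracpart (opt q P u a + i%:R * alpha))
   (b := fun i => opt q P u (a + i)) _ _) _.
- by move=> i _; have /andP[? /ltW ?] := fracpart01 (opt q P u a + i%:R * alpha); rewrite ger0_norm.
- by move=> i _; have /andP[? ?] := yb (a + i)%N; rewrite ger0_norm; lra.
apply: le_trans (_ : \sum_(i < n) h <= _); last first.
  by rewrite sumr_const card_ord -[leLHS]mulr_natl.
apply: ler_sum => i _; rewrite e // addrC addKr normrM ler_pM // ger0_norm // ler_nat.
by apply: leq_trans nd; exact: ltnW.
Qed.

End FractionalOrbit.

Local Open Scope classical_set_scope.

(** * Integrals over the unit interval *)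

Section UnitIntervalIntegrals.
Variable R : realType.
Local Notation mu := (@lebesgue_measure R).
Local Notation D01 := (`[0, 1]%classic : set R).

Definition Ip (p : R) (f : R -> R) : \bar R :=
  (\int[mu]_(x in D01) (`|f x| `^ p)%:E)%E.

Lemma measurable_D01 : measurable D01. Proof. exact: measurable_itv. Qed.
Hint Resolve measurable_D01 : core.

Lemma mu_D01 : mu D01 = 1%E.
Proof. by rewrite lebesgue_measure_itv /= lte01 oppr0 adde0. Qed.

Lemma mu_itv_le (a b x : R) : 0 <= x -> b - a <= x -> (mu `[a, b]%classic <= x%:E)%E.
Proof.
move=> x0 ab; rewrite lebesgue_measure_itv /=; case: ifP => _; last by rewrite lee_fin.
by rewrite -EFinB lee_fin.
Qed.

Lemma bigsetU_itv_measurable (I : Type) (s : seq I) (a b : I -> R) :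
  measurable (\big[setU/set0]_(i <- s) `[a i, b i]%classic : set R).
Proof. by apply: bigsetU_measurable => i _; exact: measurable_itv. Qed.

Lemma mu_bigsetU_itv_le (I : Type) (s : seq I) (a b : I -> R) (l : R) : 0 <= l ->
  (forall i, b i - a i <= l) ->
  (mu (\big[setU/set0]_(i <- s) `[a i, b i]%classic) <= ((size s)%:R * l)%:E)%E.
Proof.
move=> l0 ab; elim: s => [|i s IH] /=.
  by rewrite big_nil measure0 mul0r.
rewrite big_cons; apply: le_trans (measureU2 _ _ _) _.
- exact: measurable_itv.
- exact: bigsetU_itv_measurable.
by rewrite -natr1 mulrDl mul1r addrC EFinD; apply: leeD => //; exact: mu_itv_le.
Qed.

Lemma measurable_powR_norm (p : R) (f : R -> R) (D : set R) :
  measurable D -> measurable_fun D f ->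
  measurable_fun D (EFin \o (fun x => `|f x| `^ p)).
Proof.
move=> mD mf; apply/measurable_EFinP.
apply: (measurableT_comp (measurable_powR p)).
by apply: measurableT_comp.
Qed.

(** In the application [E1] surrounds the points j/q and [E2] is where the determinant is small. The
    integrand is dominated by the sum of the three levels. *)
Lemma Ip_le (p e b c x1 x2 : R) (f : R -> R) (E1 E2 : set R) :
  0 < p -> measurable_fun D01 f -> measurable E1 -> measurable E2 ->
  0 <= e -> 0 <= b -> 0 <= c ->
  (mu E1 <= x1%:E)%E -> (mu E2 <= x2%:E)%E ->
  (forall t : R, 0 <= t <= 1 -> `|f t| <= c) ->
  (forall t : R, 0 <= t <= 1 -> ~ E1 t -> `|f t| <= b) ->
  (forall t : R, 0 <= t <= 1 -> ~ E1 t -> ~ E2 t -> `|f t| <= e) ->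
  (Ip p f <= (e `^ p + b `^ p * x2 + c `^ p * x1)%:E)%E.
Proof.
move=> p0 mf mE1 mE2 e0 b0 c0 E1x E2x fc fb fe.
have mindic (E : set R) k : measurable E -> measurable_fun D01 (EFin \o (fun x : R => k * \1_E x)).
  by move=> mE; apply/measurable_EFinP; apply: measurable_funM => //; apply: measurable_indic.
pose g x := ((e `^ p)%:E + ((b `^ p * \1_E2 x)%:E + (c `^ p * \1_E1 x)%:E))%E.
have int (E : set R) k : 0 <= k -> measurable E ->
   (\int[mu]_(x in D01) (k * \1_E x)%:E <= k%:E * mu E)%E.
  move=> k0 mE; under eq_integral do rewrite EFinM.
  rewrite ge0_integralZl_EFin //.
  rewrite integral_indic //; apply: lee_wpmul2l; first by rewrite lee_fin.
  by apply: le_measure; rewrite ?inE //; exact: measurableI.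
  by apply/measurable_EFinP; apply: measurable_indic.
rewrite /Ip; apply: (@le_trans _ _ (\int[mu]_(x in D01) g x)%E).
  apply: ge0_le_integral => //.
  - exact: measurable_powR_norm.
  - apply: emeasurable_funD => //; apply: emeasurable_funD; exact: mindic.
  move=> x; rewrite /= in_itv /= => x01; rewrite /g -!EFinD lee_fin.
  have [/mem_set E1x'|nE1] := pselect (E1 x).
    rewrite [in X in _ + X]indicE [\1_E1 x]indicE E1x' mulr1.
    apply: (@le_trans _ _ (c `^ p)).
      by apply: ge0_ler_powR; rewrite ?nnegrE ?(ltW p0) // fc.
    by rewrite addrA lerDr addr_ge0 ?mulr_ge0 ?powR_ge0.
  have [/mem_set E2x'|nE2] := pselect (E2 x).
    rewrite [\1_E2 x]indicE E2x' mulr1.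
    apply: (@le_trans _ _ (b `^ p)).
      by apply: ge0_ler_powR; rewrite ?nnegrE ?(ltW p0) // fb.
    by rewrite addrCA lerDl addr_ge0 ?mulr_ge0 ?powR_ge0.
  apply: (@le_trans _ _ (e `^ p)).
    by apply: ge0_ler_powR; rewrite ?nnegrE ?(ltW p0) // fe.
  by rewrite lerDl addr_ge0 ?mulr_ge0 ?powR_ge0.
rewrite ge0_integralD //=; first last.
- by apply: emeasurable_funD; exact: mindic.
- by move=> x _; rewrite adde_ge0 // lee_fin mulr_ge0 ?powR_ge0.
- by move=> x _; rewrite lee_fin powR_ge0.
rewrite ge0_integralD //=; first last.
- exact: mindic.
- by move=> x _; rewrite lee_fin mulr_ge0 ?powR_ge0.
- exact: mindic.
- by move=> x _; rewrite lee_fin mulr_ge0 ?powR_ge0.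
rewrite integral_cst // [X in (_ * X)%E](_ : _ = 1%E); last exact: mu_D01.
rewrite mule1 !EFinD -addeA.
apply: leeD => //.  apply: leeD; apply: le_trans (int _ _ _ _) _; rewrite ?powR_ge0 //.
  by rewrite EFinM; apply: lee_wpmul2l => //; rewrite lee_fin powR_ge0.
by rewrite EFinM; apply: lee_wpmul2l => //; rewrite lee_fin powR_ge0.
Qed.

Lemma leb01_integral (f : R -> \bar R) : measurable_fun setT f -> (forall x, 0 <= f x)%E ->
  (\int[leb01 R]_x f x = \int[mu]_(x in D01) f x)%E.
Proof.
move=> mf f0.
rewrite (@ge0_negligible_integral _ _ _ (leb01 R) _ (~` D01)) //.
- rewrite setTD setCK; apply: eq_measure_integral => A mA AD.
  by rewrite /leb01 /= /mrestr setIidl.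
- exact: measurableC.
- by rewrite /leb01 /= /mrestr setICl measure0.
Qed.

End UnitIntervalIntegrals.

(** * One approximation step with a fixed denominator *)

Section Step.
Variable R : realType.
Local Notation D01 := (`[0, 1]%classic : set R).

Lemma measurable_fracpart : measurable_fun [set: R] (@fracpart R).
Proof.
apply: measurable_funB => //; apply: nondecreasing_measurable => // x y xy.
by rewrite ler_int; exact: le_floor.
Qed.

Lemma measurable_bis (alpha : R) n : measurable_fun [set: R] (bis alpha n).
Proof.
elim: n => [|n IH] /=; first exact: measurable_cst.
apply: measurable_funM => //; apply: (measurableT_comp IH).
by apply: (measurableT_comp measurable_fracpart); apply: measurable_funD.
Qed.

Definition lcomb (alpha : R) (l : seq (R * nat)) (t : R) : R :=
  \sum_(x <- l) x.1 * bis alpha x.2 t.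

Lemma measurable_lcomb alpha l : measurable_fun [set: R] (lcomb alpha l).
Proof.
apply: measurable_sum => x; apply: measurable_funM => //.
exact: measurable_bis.
Qed.

Lemma lcomb_norm_le alpha l t : 0 <= t <= 1 ->
  `|lcomb alpha l t| <= \sum_(x <- l) `|x.1|.
Proof.
move=> t01; apply: le_trans (ler_norm_sum _ _ _) _; apply: ler_sum => x _.
have /andP[? ?] := bis01 alpha x.2 t01.
by rewrite normrM -[leRHS]mulr1 ler_wpM2l // ger0_norm.
Qed.

Lemma mem_bigsetU (T : Type) (I : eqType) (s : seq I) (F : I -> set T) i t :
  i \in s -> F i t -> (\big[setU/set0]_(j <- s) F j) t.
Proof.
elim: s => // j s IH; rewrite inE big_cons => /orP[/eqP<-|/IH H Ft]; [left|right] => //.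
exact: H.
Qed.

Lemma unit_cell (q : nat) (h t : R) : (0 < q)%N -> 0 <= h -> 0 <= t <= 1 ->
  (forall j, (j <= q)%N -> t < j%:R / q%:R - h \/ j%:R / q%:R + h < t) ->
  exists j (u : R), [/\ (j < q)%N, t = (u + j%:R) / q%:R, 0 <= u, u < 1 &
    q%:R * h < u /\ u < 1 - q%:R * h].
Proof.
move=> q0 h0 /andP[t0 t1'] tE.
have qR0 : 0 < q%:R :> R by rewrite ltr0n.
have t1 : t < 1 by case: (tE q (leqnn _)); rewrite divff ?gt_eqF // => ?; lra.
pose j := Num.truncn (q%:R * t).
have /truncn_itv/andP[] : 0 <= q%:R * t by rewrite mulr_ge0.
rewrite -/j => jl ju.
have jq : (j < q)%N by rewrite -(ltr_nat R) (le_lt_trans jl) // gtr_pMr.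
have [u uE] : exists u : R, u = q%:R * t - j%:R by exists (q%:R * t - j%:R).
have tu : t = (u + j%:R) / q%:R by rewrite uE subrK mulrAC divff ?mul1r // gt_eqF.
have /andP[u0 u1] : 0 <= u < 1.
  by rewrite uE; move: ju; rewrite -natr1 => ju; apply/andP; split; lra.
have uq0 : 0 <= u / q%:R by rewrite divr_ge0.
have jE := tE j (ltnW jq); have j1E := tE j.+1 jq.
exists j, u; split => //; split.
- case: jE; rewrite tu mulrDl => H; first by lra.
  by move: H; rewrite addrC ltrD2r ltr_pdivlMr // mulrC.
- have uq1 : u / q%:R <= 1 / q%:R by rewrite ler_pM2r ?invr_gt0 // ltW.
  case: j1E; rewrite tu -natr1 !mulrDl mul1r => H; last by lra.
  have {}H : u / q%:R < 1 / q%:R - h by lra.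
  by move: H; rewrite ltr_pdivrMr // mulrBl divfK ?gt_eqF // (mulrC h).
Qed.

Lemma index_le (q N n k : nat) : (n < N.+1)%N -> (k < q)%N -> (n * q + k <= q * N + q - 1)%N.
Proof.
rewrite ltnS => nN kq; have : (n * q <= N * q)%N by rewrite leq_mul2r nN orbT.
lia.
Qed.

Lemma add_err_le (x o a c e b : R) : x <= o + a + c -> a <= e + b -> x <= c + e + o + b.
Proof. by move=> *; lra. Qed.

(** The target is sampled at the left ends of the cells of length 1/q, at the price of [osc]. The
    other terms of [err] come from the change of angle and from Bernstein approximation, and d is
    the largest exponent n q + k that occurs. *)
Lemma bishop_approx_step (p alpha : R) (q P N K : nat)
    (tau theta theta1 B delta osc : R) (g : R -> R) :
  0 < p -> (0 < q)%N -> coprime P q -> (0 < N)%N -> (0 < K)%N ->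
  0 < tau -> tau <= 1 -> 0 < theta -> theta <= 1 -> 0 < theta1 -> 0 <= B ->
  tau * (2 * (K * (q * q))%:R) ^+ (q * q) / (q * q)`!%:R < (q%:R ^+ 'C(q, 2))^-1 ->
  `|alpha - P%:R / q%:R| <= delta -> measurable_fun D01 g ->
  (forall t : R, 0 <= t <= 1 -> `|g t| <= B) -> 0 <= osc ->
  (forall s t : R, 0 <= s <= 1 -> 0 <= t <= 1 -> `|s - t| <= q%:R^-1 -> `|g s - g t| <= osc) ->
  let eta := theta * tau in
  let L := 2 * B * (q%:R * q`!%:R) ^+ 2 / eta ^+ 2 * q%:R ^+ q in
  let C := q%:R * (3 ^+ N * (eta^-1 * (q%:R * (q`!%:R * B)))) in
  let d := (q * N + q - 1)%N in
  let h := d%:R * delta in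
  let err := C * (d%:R * h) + q%:R * (theta1 + L ^+ 2 / (4 * theta1 * N%:R)) + osc in
  exists l, (Ip p (fun t => g t - lcomb alpha l t)%R <=
    ((err + B * theta ^+ 2) `^ p + (err + B) `^ p * (2 / K%:R)
     + (B + C) `^ p * (q.+1%:R * (2 * h)))%:E)%E.
Proof.
move=> p0 q0 copP N0 K0 tau0 tau1 th0 th1 th10 B0 small ad mg gB osc0 gosc eta L C d h err.
have qR0 : 0 < q%:R :> R by rewrite ltr0n.
have dl0 : 0 <= delta by apply: le_trans ad.
have h0 : 0 <= h by rewrite mulr_ge0.
have eta0 : 0 < eta by rewrite mulr_gt0.
have C0 : 0 <= C by rewrite !mulr_ge0 ?exprn_ge0 ?invr_ge0 // ltW.
pose G (m : 'I_q) := g ((orbn q P (q - m))%:R / q%:R).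
have in01 (j : nat) : (j < q)%N -> 0 <= (j%:R / q%:R : R) <= 1.
  by move=> jq; rewrite divr_ge0 //= ler_pdivrMr // mul1r ler_nat ltnW.
have GB m : `|G m| <= B by apply: gB; apply: in01; rewrite orbn_lt.
have [a [aC aP]] := rational_approximant q0 copP N0 tau0 tau1 th0 th1 th10 B0 GB.
rewrite -/eta -/L -/C in aC aP.
pose l := [seq (a x.1 x.2, x.2 * q + x.1)%N | x <- [seq (k, n) | k <- iota 0 q, n <- iota 0 N.+1]].
have sumE (F : nat -> nat -> R) : \sum_(x <- [seq (k, n) | k <- iota 0 q, n <- iota 0 N.+1]) F x.1 x.2
   = \sum_(k < q) \sum_(n < N.+1) F k n.
  rewrite big_allpairs -[in LHS](subn0 q) -/(index_iota 0 q) big_mkord.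
  by apply: eq_bigr => k _; rewrite -[in LHS](subn0 N.+1) -/(index_iota 0 N.+1) big_mkord.
have lE t : lcomb alpha l t = \sum_(k < q) \sum_(n < N.+1) a k n * bis alpha (n * q + k) t.
  by rewrite /lcomb big_map /= (sumE (fun k n => a k n * bis alpha (n * q + k) t)).
have lC : \sum_(x <- l) `|x.1| <= C.
  by rewrite big_map /= (sumE (fun k n => `|a k n|)).
exists l.
set n0 := (q * q)%N; set Q := (K * n0)%N.
have n00 : (0 < n0)%N by rewrite muln_gt0 q0.
have Q0 : (0 < Q)%N by rewrite muln_gt0 K0.
have QR0 : 0 < Q%:R :> R by rewrite ltr0n.
pose bad (i : nat) := `[< exists u : R, [/\ i%:R <= Q%:R * u, Q%:R * u <= i.+1%:R &
    `|(\det (omxp R q P)).[u]| <= tau] >].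
have fewbad : (count bad (iota 0 Q) <= 2 * n0)%N.
  apply: (@few_small_intervals _ n0 K tau (\det (omxp R q P))) => //.
  - exact: size_det_omxp.
  - apply: (lt_le_trans small); rewrite horner_omxp_det.
    by apply: le_trans (ler_norm _); exact: det_omx0.
  - by move=> i _ /asboolP.
(* The bad cells for u are copied into each of the q cells for t: at most 2 q^2 q intervals of
   length 1/(Q q) with Q = K q^2, of total length 2/K. *)
pose s2 := [seq (i, j) | i <- seq.filter bad (iota 0 Q), j <- iota 0 q].
pose lo (x : nat * nat) : R := (x.1%:R / Q%:R + x.2%:R) / q%:R.
pose hi (x : nat * nat) : R := (x.1.+1%:R / Q%:R + x.2%:R) / q%:R.
pose E2 : set R := \big[setU/set0]_(x <- s2) `[lo x, hi x]%classic.
(* Around these points the perturbed orbit may wrap differently, and only the bound C on the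
   coefficients is used. *)
pose E1 : set R := \big[setU/set0]_(j <- iota 0 q.+1) `[j%:R / q%:R - h, j%:R / q%:R + h]%classic.
have E2le : (lebesgue_measure E2 <= (2 / K%:R)%:E)%E.
  apply: le_trans (@mu_bigsetU_itv_le _ _ s2 lo hi (Q%:R * q%:R)^-1 _ _) _.
  - by rewrite invr_ge0 mulr_ge0.
  - by move=> x; rewrite /hi /lo -natr1 le_eqVlt; apply/orP; left; apply/eqP; field; rewrite !gt_eqF.
  rewrite lee_fin size_allpairs size_filter size_iota.
  rewrite ler_pdivrMr ?mulr_gt0 //.
  rewrite (_ : 2 / K%:R * _ = (2 * n0 * q)%:R); last first.
    by rewrite /Q !natrM; field; rewrite gt_eqF // ltr0n.
  by rewrite ler_nat leq_mul2r fewbad orbT.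
have E1le : (lebesgue_measure E1 <= (q.+1%:R * (2 * h))%:E)%E.
  apply: le_trans (@mu_bigsetU_itv_le _ _ (iota 0 q.+1) _ _ (2 * h) _ _) _.
  - by rewrite mulr_ge0.
  - by move=> j; rewrite opprD opprK addrACA subrr add0r mulr_natl mulr2n.
  by rewrite size_iota.
have err0 : 0 <= err.
  apply: addr_ge0 => //; apply: addr_ge0.
    by apply: mulr_ge0 => //; apply: mulr_ge0.
  apply: mulr_ge0 => //; apply: addr_ge0; first exact: ltW.
  by rewrite divr_ge0 ?sqr_ge0 // !mulr_ge0 // ltW.
have key (t : R) : 0 <= t <= 1 -> ~ E1 t -> `|g t - lcomb alpha l t| <= err + B /\
    (~ E2 t -> `|g t - lcomb alpha l t| <= err + B * theta ^+ 2).
  move=> t01 nE1; have /andP[t0 t1'] := t01.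
  have tE j : (j <= q)%N -> t < j%:R / q%:R - h \/ j%:R / q%:R + h < t.
    move=> jq; apply/orP; rewrite !ltNge -negb_and; apply/negP => H.
    by apply: nE1; apply: (@mem_bigsetU _ _ _ _ j); rewrite ?mem_iota //= in_itv.
  have [j [u [jq tu u0 u1 [uh uh']]]] := unit_cell q0 h0 t01 tE.
  have u01 : 0 <= u <= 1 by rewrite u0 ltW.
  (* The row m is the one whose starting point lies in the cell j of t. *)
  have [m mq mj] := orbn_surj q0 copP jq.
  have tO : t = opt q P u (q - m) by rewrite /opt mj.
  have [aP1 aP2] := aP (Ordinal mq) u u01.
  set A := (X in `|X - G _| <= _ + B) in aP1.
  have FA : `|lcomb alpha l t - A| <= C * (d%:R * h).
    rewrite lE /A -sumrB; apply: le_trans (ler_norm_sum _ _ _) _.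
    apply: (@le_trans _ _ (\sum_(k < q) \sum_(n < N.+1) `|a k n| * (d%:R * h))).
      apply: ler_sum => k _; rewrite -sumrB; apply: le_trans (ler_norm_sum _ _ _) _.
      apply: ler_sum => n _; rewrite -mulrBr normrM; apply: ler_wpM2l => //.
      have nd : (n * q + k <= d)%N by exact: index_le.
      rewrite tO; apply: le_trans (@bis_near_rational _ alpha q P d _ (q - m) delta u q0 ad nd uh uh') _.
      by apply: ler_wpM2r => //; rewrite ler_nat.
    rewrite [leLHS](_ : _ = (\sum_(k < q) \sum_(n < N.+1) `|a k n|) * (d%:R * h)).
      by rewrite ler_wpM2r // mulr_ge0.
    by rewrite big_distrl /=; apply: eq_bigr => k _; rewrite big_distrl.
  have gG :`|g t - G (Ordinal mq)| <= osc.
    apply: gosc => //; first by rewrite /= mj; exact: in01.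
    by rewrite /= mj tu -mulrBl addrK ger0_norm ?divr_ge0 // ler_piMl ?invr_ge0 // ltW.
  have E0 :`|g t - lcomb alpha l t| <= osc + `|A - G (Ordinal mq)| + C * (d%:R * h).
    have -> : g t - lcomb alpha l t =
        (g t - G (Ordinal mq)) - (A - G (Ordinal mq)) - (lcomb alpha l t - A) by ring.
    apply: le_trans (ler_normB _ _) _; apply: lerD => //.
    by apply: le_trans (ler_normB _ _) _; apply: lerD.
  split=> [|nE2]; first exact: add_err_le E0 aP1.
  have Dt :tau <= `|\det (omx q P u)|.
    rewrite leNgt; apply/negP => Dlt; apply: nE2.
    set i := Num.truncn (Q%:R * u).
    have /truncn_itv/andP[il iu] : 0 <= Q%:R * u by rewrite mulr_ge0.
    have iQ : (i < Q)%N by rewrite -(ltr_nat R) (le_lt_trans il) // gtr_pMr.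
    apply: (@mem_bigsetU _ _ _ _ (i, j)).
      apply: allpairs_f; rewrite ?mem_iota // mem_filter mem_iota /= iQ andbT.
      by apply/asboolP; exists u; split => //; rewrite ?horner_omxp_det ltW.
    rewrite /= in_itv /lo /hi /= tu !ler_pM2r ?invr_gt0 // !lerD2r.
    by rewrite ler_pdivrMr // ler_pdivlMr // mulrC il (ltW iu).
  exact: add_err_le E0 (aP2 Dt).
apply: (Ip_le p0 _ _ _ _ _ _ E1le E2le) => //.
- apply: measurable_funB => //; apply: measurable_funTS; exact: measurable_lcomb.
- exact: bigsetU_itv_measurable.
- exact: bigsetU_itv_measurable.
- by rewrite addr_ge0 // mulr_ge0 ?sqr_ge0.
- by rewrite addr_ge0.
- by rewrite addr_ge0.
- move=> t t01; apply: le_trans (ler_normB _ _) _; apply: lerD; first exact: gB.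
  by apply: le_trans (lcomb_norm_le _ _ t01) _.
- by move=> t t01 nE1; have [] := key t t01 nE1.
- by move=> t t01 nE1 nE2; have [_] := key t t01 nE1; apply.
Qed.

End Step.

(** * The constants *)

Lemma measure_bound_rearrange (R : realFieldType) (c b dl d e : R) :
  0 < c -> 0 < b -> 0 < d -> 0 < dl ->
  dl * (4 * c * (b * d)) <= e -> c * (d * dl) * b <= e.
Proof.
move=> c0 b0 d0 dl0 /(le_trans _); apply.
rewrite [leRHS](_ : _ = 4 * (c * (d * dl) * b)); last by ring.
by rewrite ler_peMl ?mulr_ge0 ?ltW //; lra.
Qed.

Lemma perturbation_bound_rearrange (R : realFieldType) (c b dl d e C : R) :
  1 <= C -> 1 <= d -> C <= c -> d <= b -> 0 < dl ->
  dl * (4 * c * (b * d)) <= e -> C * (d * (d * dl)) <= e.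
Proof.
move=> C1 d1 Cc db dl0 /(le_trans _); apply.
rewrite [leLHS](_ : _ = dl * d * (C * d)); last by ring.
rewrite [leRHS](_ : _ = dl * d * (4 * (c * b))); last by ring.
apply: ler_wpM2l; first by rewrite mulr_ge0 ?ltW //; lra.
apply: (@le_trans _ _ (c * b)); first by apply: ler_pM => //; lra.
by rewrite ler_peMl ?mulr_ge0 //; lra.
Qed.

Section PsiBounds.
Variables (R : realType) (p : R) (q : nat).
Hypotheses (p1 : 1 < p) (q3 : (2 < q)%N).

Let q0 : (0 < q)%N. Proof. exact: ltn_trans q3. Qed.
Let qR0 : 0 < q%:R :> R. Proof. by rewrite ltr0n. Qed.
Let qR1 : 1 <= q%:R :> R. Proof. by rewrite ler1n. Qed.
Let p0 : 0 < p. Proof. exact: lt_trans p1. Qed.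

Lemma psi_sE : psi_s q = 'C(q, 2).
Proof. by rewrite bin2 -divn2 /psi_s subn1. Qed.

Lemma psi_eps_gt0 : 0 < psi_eps R q.
Proof. by rewrite invr_gt0 ltr_wpDl. Qed.

Lemma psi_eps_powR_le : psi_eps R q `^ p <= (q%:R `^ p)^-1.
Proof.
rewrite -[leRHS]mul1r ler_pdivlMr ?powR_gt0 // -powRM ?(ltW psi_eps_gt0) //.
rewrite -[leRHS](_ : 1 `^ p = 1); last by rewrite powR1.
apply: ge0_ler_powR; rewrite ?nnegrE ?(ltW p0) ?ler01 //.
  by rewrite mulr_ge0 // ltW // psi_eps_gt0.
by rewrite /psi_eps mulrC ler_pdivrMr ?ltr_wpDl // mul1r lerDl.
Qed.

Let qp_ge1 : 1 <= q%:R `^ p :> R.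
Proof. by apply: le_trans (le1r_powR qR1 (ltW p1)). Qed.

Let qp_gt0 : 0 < q%:R `^ p :> R.
Proof. exact: lt_le_trans qp_ge1. Qed.

(* A lower bound of 1 / psi_eta. *)
Definition psi_low : R := q%:R ^+ 'C(q, 2) * (q%:R `^ p) ^+ psi_ell q.

Lemma psi_low_ge1 : 1 <= psi_low.
Proof. by rewrite mulr_ege1 // exprn_ege1. Qed.

Lemma psi_eta_gt0 : 0 < psi_eta p q.
Proof.
rewrite /psi_eta gtn_eqF // !mulr_gt0 ?invr_gt0 ?exprn_gt0 //.
by rewrite divr_gt0 // powR_gt0 // psi_eps_gt0.
Qed.

Lemma psi_eta_le : psi_eta p q <= psi_low^-1.
Proof.
rewrite /psi_eta gtn_eqF // /psi_low invfM /psi_b psi_sE; apply: ler_pM.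
- by rewrite divr_ge0 // invr_ge0 exprn_ge0.
- by rewrite exprn_ge0 // divr_ge0 // powR_ge0.
- by rewrite ler_piMr ?invr_ge0 ?exprn_ge0 //; lra.
rewrite -exprVn lerXn2r // ?nnegrE ?divr_ge0 ?invr_ge0 ?powR_ge0 //.
apply: le_trans psi_eps_powR_le; rewrite ler_piMr ?powR_ge0 //; lra.
Qed.

Lemma psi_H_ge : q`!%:R * psi_low <= psi_H p q.
Proof.
rewrite /psi_H ler_wpM2l // -[psi_low]invrK lef_pV2 ?posrE ?psi_eta_gt0 //.
  exact: psi_eta_le.
by rewrite invr_gt0 (lt_le_trans _ psi_low_ge1).
Qed.

Lemma psi_Gamma_ge : 3 <= psi_Gamma R q.
Proof. by rewrite /psi_Gamma lerDl divr_ge0 // divr_ge0 // exprn_ge0. Qed.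

(** The last summand of [psi_L] is at least the inverse square of [psi_eta]. *)
Lemma psi_L_ge : psi_low ^+ 2 <= psi_L p q.
Proof.
have e0 := psi_eta_gt0.
have f1 : 1 <= q`!%:R :> R by rewrite ler1n fact_gt0.
apply: (@le_trans _ _ (2 * q`!%:R ^+ 2 * q%:R ^+ 2 / psi_eta p q ^+ 2)); last first.
  have H1 : 0 <= psi_H p q / psi_a p q.
    by rewrite divr_ge0 // divr_ge0 ?powR_ge0 ?mulr_ge0 // ltW.
  have H2 : 0 <= q`!%:R * q%:R * (q%:R - 1 + pi) / psi_eta p q.
    rewrite divr_ge0 ?(ltW e0) // mulr_ge0 ?mulr_ge0 //.
    by rewrite addr_ge0 ?pi_ge0 // subr_ge0.
  by rewrite /psi_L lerDr addr_ge0.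
rewrite -exprVn -[leLHS]mul1r; apply: ler_pM => //.
- by rewrite exprn_ge0 // (le_trans _ psi_low_ge1).
- by rewrite !mulr_ege1 ?exprn_ege1 //; lra.
rewrite lerXn2r ?nnegrE ?invr_ge0 ?(ltW e0) ?(le_trans _ psi_low_ge1) //.
by rewrite -[psi_low]invrK lef_pV2 ?posrE ?psi_eta_le // invr_gt0 (lt_le_trans _ psi_low_ge1).
Qed.

Lemma psi_Lambda_ge : psi_low ^+ 2 <= psi_Lambda p q.
Proof.
rewrite /psi_Lambda le_max; apply/orP; right.
have l0 : 0 <= psi_low ^+ 2 by rewrite sqr_ge0.
apply: (le_trans psi_L_ge).
have L0 : 0 <= psi_L p q by apply: le_trans psi_L_ge.
rewrite ler_pdivlMr ?psi_eps_gt0 //; apply: (@le_trans _ _ (psi_L p q)).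
  by rewrite ler_piMr // /psi_eps invf_le1 ?lerDr // ltr_wpDl.
rewrite ler_peMl // mulr_ege1 //; have := pi_ge2 R; lra.
Qed.

(** The logarithm is at least 1, its argument being at least e, so [psi_N] is at least
    [psi_Lambda]. *)
Lemma psi_N_ge : psi_low ^+ 2 <= (psi_N p q)%:R.
Proof.
have L1 : 1 <= psi_Lambda p q by rewrite /psi_Lambda le_max lexx.
have ln1 : 1 <= ln (4 * psi_Lambda p q + expR 1).
  have e0 := expR_gt0 (1 : R).
  rewrite -[leLHS](expRK 1); rewrite ler_ln ?posrE ?expR_gt0 //; lra.
rewrite /psi_N; set x := 4 * psi_Lambda p q * ln _.
have xge : psi_low ^+ 2 <= x.
  apply: (le_trans psi_Lambda_ge); rewrite /x -mulrA mulrCA ler_peMr //; first lra.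
  by rewrite mulr_ege1 //; lra.
have x0 : 0 <= x by apply: le_trans xge; rewrite sqr_ge0.
rewrite natr_absz gtr0_norm ?ceil_gt0.
  exact: le_trans xge (ceil_ge _).
by apply: lt_le_trans xge; rewrite exprn_gt0 // (lt_le_trans _ psi_low_ge1).
Qed.

Lemma psi_N_gt0 : (0 < psi_N p q)%N.
Proof.
rewrite -(ltr_nat R); apply: lt_le_trans psi_N_ge.
by rewrite exprn_gt0 // (lt_le_trans _ psi_low_ge1).
Qed.

Lemma psi_d_ge : (q <= psi_d p q)%N.
Proof.
have := leq_mul (leqnn q) psi_N_gt0; rewrite /psi_d muln1 => H; lia.
Qed.

(** The factor 3^N is the growth of the Bernstein coefficients; the factor N will dominate the
    remaining constants, among them 1/tau. *)
Lemma psi_C_ge : q%:R * q`!%:R * (psi_N p q)%:R * 3 ^+ psi_N p q <= psi_C p q.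
Proof.
rewrite /psi_C; apply: ler_pM; rewrite ?mulr_ge0 ?exprn_ge0 //.
  apply: ler_wpM2r => //; apply: ler_pM; rewrite ?mulr_ge0 //.
    by rewrite ler_peMl //; lra.
  by apply: le_trans psi_H_ge; rewrite ler_peMr // psi_low_ge1.
by rewrite lerXn2r ?nnegrE ?psi_Gamma_ge //; apply: le_trans psi_Gamma_ge.
Qed.

Lemma psi_C_ge1 : 1 <= psi_C p q.
Proof.
apply: le_trans psi_C_ge; rewrite !mulr_ege1 ?exprn_ege1 ?ler1n ?fact_gt0 ?psi_N_gt0 //; lra.
Qed.

Lemma psi_delta_gt0 : 0 < psi_delta p q.
Proof.
have d0 : 0 < (psi_d p q)%:R :> R by rewrite ltr0n (leq_trans q0 psi_d_ge).
have C0 : 0 < psi_C p q by apply: lt_le_trans psi_C_ge1.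
rewrite /psi_delta lt_min !divr_gt0 ?mulr_gt0 ?powR_gt0 ?psi_eps_gt0 //.
Qed.

Lemma psi_delta_le :
  psi_delta p q <= psi_eps R q `^ p / (4 * psi_C p q `^ p * (psi_d p q)%:R `^ (p + 1)).
Proof. by rewrite /psi_delta ge_min lexx orbT. Qed.

Let d1 : 1 <= (psi_d p q)%:R :> R.
Proof. by rewrite ler1n (leq_trans q0 psi_d_ge). Qed.

(** Near the points j/q the error to the power p is of order C^p on a set of length of order q d
    delta, so the bound q^-2 leaves O(1/q). One factor 1/q comes from [psi_eps], the other from d^-p
    with d >= q. *)
Lemma psi_delta_measure : psi_C p q `^ p * ((psi_d p q)%:R * psi_delta p q) <= (q%:R ^+ 2)^-1.
Proof.
have C0 : 0 < psi_C p q by apply: lt_le_trans psi_C_ge1.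
have d0 : 0 < (psi_d p q)%:R :> R by apply: lt_le_trans d1.
apply: (@le_trans _ _ (psi_eps R q `^ p / (psi_d p q)%:R `^ p)).
  rewrite ler_pdivlMr ?powR_gt0 //.
  have := psi_delta_le; rewrite ler_pdivlMr ?mulr_gt0 ?powR_gt0 //.
  rewrite powRD ?(gt_eqF d0) ?implybT // powRr1 ?(ltW d0) //.
  by apply: measure_bound_rearrange; rewrite ?powR_gt0 // psi_delta_gt0.
rewrite expr2 invfM; apply: ler_pM; rewrite ?powR_ge0 ?invr_ge0 ?powR_ge0 //.
  apply: le_trans psi_eps_powR_le _; rewrite lef_pV2 ?posrE //.
  exact: le1r_powR qR1 (ltW p1).
rewrite lef_pV2 ?posrE ?powR_gt0 //.
by apply: le_trans (le1r_powR d1 (ltW p1)); rewrite ler_nat psi_d_ge.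
Qed.

(** This bounds the cost of the change of angle: C for the coefficients, d (d delta) for an iterate.
    As p > 1, the denominator C^p d^(p+1) of [psi_delta] dominates C d^2. *)
Lemma psi_delta_perturb : psi_C p q * ((psi_d p q)%:R * ((psi_d p q)%:R * psi_delta p q)) <= q%:R^-1.
Proof.
have C0 : 0 < psi_C p q by apply: lt_le_trans psi_C_ge1.
have d0 : 0 < (psi_d p q)%:R :> R by apply: lt_le_trans d1.
have qp : (q%:R `^ p)^-1 <= q%:R^-1 :> R.
  by rewrite lef_pV2 ?posrE //; exact: le1r_powR qR1 (ltW p1).
apply: le_trans qp; apply: le_trans psi_eps_powR_le.
have := psi_delta_le; rewrite ler_pdivlMr ?mulr_gt0 ?powR_gt0 //.
rewrite powRD ?(gt_eqF d0) ?implybT // powRr1 ?(ltW d0) //.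
by apply: perturbation_bound_rearrange; rewrite ?le1r_powR ?psi_C_ge1 ?(ltW p1) // psi_delta_gt0.
Qed.

End PsiBounds.

(** With x = q these are the exponents of q in [psi_low_dominates] after q^(q(q-1)) is cancelled.
    The coefficients of x^2 are 2(p-1)/3 + 1 and p; the remaining (p-1)/3 absorbs the linear
    terms. *)
Lemma exponent_le (R : realFieldType) (x p : R) : 1 < p -> 0 <= x ->
  11 + 3 * p <= (p - 1) / 3 * x ->
  (p - 1) / 3 * (x * x + x * x) + (12 * x + x * (x - 1)) <= p * ((x - 1) * (x - 2)).
Proof.
move=> p1 x0 h; rewrite -subr_ge0.
rewrite [leRHS](_ : _ = x * ((p - 1) / 3 * x - (11 + 3 * p)) + 2 * p); last by field.
by rewrite addr_ge0 ?mulr_ge0 ?subr_ge0 //; lra.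
Qed.

Lemma bin2_double n : ('C(n, 2) * 2 = n * (n - 1))%N.
Proof. by have := bin_ffact n 2; rewrite !ffactnS ffactn0 muln1 subn1. Qed.

Lemma psi_low_dominates (R : realType) (p A k : R) : 1 < p -> 0 < A -> 0 < k ->
  exists q0 : nat, forall q : nat, (q0 <= q)%N ->
   A * q%:R ^+ (12 * q) * (q%:R ^+ 'C(q, 2) * k ^+ (q * q)) ^+ 4 <= psi_low p q ^+ 2.
Proof.
move=> p1 A0 k0.
set r := (p - 1) / 3; have r0 : 0 < r by rewrite divr_gt0 // subr_gt0.
set M := 1 + A + k ^+ 4.
have M1 : 1 <= M by rewrite /M -addrA lerDl addr_ge0 // ?(ltW A0) ?exprn_ge0 ?(ltW k0).
(* With r = (p-1)/3, [t1] makes q^r exceed both A and k^4, so that A and k^(4 q^2) are each at most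
   q^(r q^2); [t2] makes q large enough for [exponent_le]. *)
have [t1 t1P] : exists t, M `^ r^-1 <= t%:R.
  by exists (Num.truncn (M `^ r^-1)).+1; rewrite ltW // truncnS_gt.
have [t2 t2P] : exists t, (11 + 3 * p) / r <= t%:R.
  by exists (Num.truncn ((11 + 3 * p) / r)).+1; rewrite ltW // truncnS_gt.
exists (t1 + t2 + 3)%N => q qq0.
have q3 : (2 < q)%N by lia.
have qR0 : 0 < q%:R :> R by rewrite ltr0n; lia.
have qR1 : 1 <= q%:R :> R by rewrite ler1n; lia.
have h1 : 11 + 3 * p <= r * q%:R.
  rewrite [leRHS]mulrC -ler_pdivrMr //; apply: le_trans t2P _.
  by rewrite ler_nat; lia.
have h2 : M <= q%:R `^ r.
  have : M `^ r^-1 <= q%:R.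
    apply: le_trans t1P _.
    by rewrite ler_nat; lia.
  move=> H; rewrite -[leLHS](_ : (M `^ r^-1) `^ r = M).
    by apply: ge0_ler_powR; rewrite ?nnegrE ?powR_ge0 ?(ltW r0).
  by rewrite -powRrM mulVf ?gt_eqF // powRr1 //; lra.
have hA : A <= (q%:R `^ r) ^+ (q * q).
  apply: (@le_trans _ _ (q%:R `^ r)).
    by apply: le_trans h2; rewrite /M; have := exprn_ge0 4 (ltW k0); lra.
  apply: ler_eXnr; last by apply: le_trans h2.
  by rewrite muln_gt0 (ltn_trans _ q3).
have hk : (k ^+ (q * q)) ^+ 4 <= (q%:R `^ r) ^+ (q * q).
  rewrite exprAC lerXn2r ?nnegrE ?powR_ge0 ?exprn_ge0 ?(ltW k0) //.
  by apply: le_trans h2; rewrite /M; lra.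
rewrite /psi_low !exprMn mulrA.
set s := q%:R ^+ 'C(q, 2).
have -> : A * q%:R ^+ (12 * q) * s ^+ 4 * (k ^+ (q * q)) ^+ 4
   = s ^+ 2 * (A * (k ^+ (q * q)) ^+ 4 * (q%:R ^+ (12 * q) * s ^+ 2)) by ring.
apply: ler_wpM2l; first by rewrite sqr_ge0.
apply: (@le_trans _ _ ((q%:R `^ r) ^+ (q * q) * (q%:R `^ r) ^+ (q * q) * (q%:R ^+ (12 * q) * s ^+ 2))).
  apply: ler_wpM2r; first by rewrite mulr_ge0 ?exprn_ge0.
  by apply: ler_pM => //; rewrite ?exprn_ge0 // ltW.
rewrite /s -!exprM -!exprD.
rewrite -!powR_mulrn ?powR_ge0 // -!powRrM -powRD ?(gt_eqF qR0) ?implybT //.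
apply: ler_powR => //.
rewrite bin2_double (_ : psi_ell q = 'C(q - 1, 2)); last first.
  by rewrite bin2 -divn2 -subn1 -subnDA.
rewrite bin2_double -subnDA addn1 (natrD _ (q * q)%N) (natrD _ (12 * q)%N) !natrM.
have [q1 q2] : (1 <= q)%N /\ (2 <= q)%N by split; apply: ltnW => //; exact: ltnW.
rewrite !natrB //.
by apply: exponent_le; rewrite -?/r.
Qed.

(** * Approximation of continuous functions *)

Section Approximation.
Variable R : realType.
Local Notation D01 := (`[0, 1]%classic : set R).

Lemma archi_upper (x : R) : exists n : nat, x <= n%:R.
Proof. by exists (Num.truncn x).+1; rewrite ltW // truncnS_gt. Qed.

(** The left side is one term of the exponential series at n. *)
Lemma expn_fact_lt (n : nat) : (0 < n)%N -> n%:R ^+ n / n`!%:R < expR 1 ^+ n :> R.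
Proof.
case: n => // n _; rewrite -expRM_natl mulr1.
by apply: lt_le_trans (expR_ge1Dxn n (ler0n _ _)); rewrite ltrDr.
Qed.

(** With n = q^2 one has (2Kn)^n / n! < (2Ke)^n, so k = 2Ke absorbs the interpolation constant for
    every q. *)
Lemma sublevel_const (q K : nat) : (0 < q)%N -> (0 < K)%N ->
  let k : R := 2 * K%:R * expR 1 in
  let tau := (q%:R ^+ 'C(q, 2) * k ^+ (q * q))^-1 in
  [/\ 1 <= k, 0 < tau, tau <= 1 &
   tau * (2 * (K * (q * q))%:R) ^+ (q * q) / (q * q)`!%:R < (q%:R ^+ 'C(q, 2))^-1].
Proof.
move=> q0 K0 k tau.
have K1 : 1 <= K%:R :> R by rewrite ler1n.
have q1 : 1 <= q%:R :> R by rewrite ler1n.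
have e1 : 1 <= expR (1 : R) by have := expR_ge1Dx (1 : R); lra.
have k1 : 1 <= k by rewrite /k !mulr_ege1 //; lra.
have k0 : 0 < k by lra.
have qC : 1 <= q%:R ^+ 'C(q, 2) :> R by rewrite exprn_ege1.
have t1 : 1 <= q%:R ^+ 'C(q, 2) * k ^+ (q * q) by rewrite mulr_ege1 ?exprn_ege1.
split => //.
- by rewrite invr_gt0 (lt_le_trans _ t1).
- by rewrite invf_le1 // (lt_le_trans _ t1).
rewrite /tau invfM -!mulrA gtr_pMr ?invr_gt0 ?(lt_le_trans _ qC) //.
rewrite mulrC ltr_pdivrMr ?exprn_gt0 // mul1r natrM mulrA exprMn /k [ltRHS]exprMn.
rewrite -mulrA ltr_pM2l ?exprn_gt0 ?mulr_gt0 ?ltr0n //.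
by apply: expn_fact_lt; rewrite muln_gt0 q0.
Qed.


Lemma fact_le_expn (q : nat) : (q`! <= q ^ q)%N.
Proof.
elim: q => // q IH; rewrite factS expnS leq_mul2l /=.
by case: q IH => // q IH; apply: leq_trans IH _; rewrite leq_exp2r.
Qed.

(** The powers of q collect to q^6 (q!)^4 q^(2q), at most q^(6q+6) because q! <= q^q; this is
    rounded up to q^(12q). *)
Lemma lip_sq_le (q : nat) (B theta tau : R) : (0 < q)%N -> 0 < theta -> 0 < tau ->
  q%:R ^+ 2 * (2 * B * (q%:R * q`!%:R) ^+ 2 / (theta * tau) ^+ 2 * q%:R ^+ q) ^+ 2
   <= 4 * (B ^+ 2 / theta ^+ 4) * (q%:R ^+ (12 * q) * tau^-1 ^+ 4).
Proof.
move=> q0 th0 tau0.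
have q1 : 1 <= q%:R :> R by rewrite ler1n.
have f0 : 0 <= q`!%:R :> R by [].
have fq : q`!%:R <= q%:R ^+ q :> R by rewrite -natrX ler_nat fact_le_expn.
have fq4 : q`!%:R ^+ 4 <= (q%:R ^+ q) ^+ 4 :> R by rewrite lerXn2r ?nnegrE ?exprn_ge0.
rewrite [leLHS](_ : _ = 4 * (B ^+ 2 / theta ^+ 4) * (q%:R ^+ 6 * q`!%:R ^+ 4 * (q%:R ^+ q) ^+ 2 * tau^-1 ^+ 4)); last first.
  by field; rewrite !gt_eqF.
apply: ler_wpM2l; first by rewrite mulr_ge0 // divr_ge0 ?sqr_ge0 // exprn_ge0 // ltW.
apply: ler_wpM2r; first by rewrite exprn_ge0 // invr_ge0 ltW.
apply: (@le_trans _ _ (q%:R ^+ 6 * (q%:R ^+ q) ^+ 4 * (q%:R ^+ q) ^+ 2)).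
  by apply: ler_wpM2r; rewrite ?exprn_ge0 //; apply: ler_wpM2l; rewrite ?exprn_ge0.
by rewrite -!exprM -!exprD; apply: ler_weXn2l => //; lia.
Qed.

Lemma coef_bound_rearrange (n T th t f b : R) :
  n * (T * ((th * t)^-1 * (n * (f * b)))) = n * f * (n * (b / th) * t^-1) * T.
Proof. by rewrite invfM; ring. Qed.

Lemma err_rearrange (n s L N : R) : 0 < n -> 0 < s -> 0 < N ->
  n * (s / n + L ^+ 2 / (4 * (s / n) * N)) = s + n ^+ 2 * L ^+ 2 / (4 * s * N).
Proof. by move=> *; field; rewrite !gt_eqF. Qed.

Lemma mul_s_rearrange (s N : R) : s * (4 * s * N) = 4 * (s ^+ 2 * N).
Proof. by ring. Qed.

Lemma sum4_le (a b s : R) : a <= s -> b <= s + s -> a + b + s <= 4 * s.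
Proof. by move=> *; lra. Qed.

Lemma approx_uniformly_continuous (p alpha B : R) (g : R -> R) :
  1 < p -> 0 <= B ->
  (forall n : nat, exists q P : nat, [/\ (n <= q)%N, coprime P q &
      `|alpha - P%:R / q%:R| <= psi_delta p q]) ->
  measurable_fun D01 g -> (forall t : R, 0 <= t <= 1 -> `|g t| <= B) ->
  (forall s : R, 0 < s -> exists2 d : R, 0 < d &
    forall x y : R, 0 <= x <= 1 -> 0 <= y <= 1 -> `|x - y| <= d -> `|g x - g y| <= s) ->
  forall e : R, 0 < e -> exists l, (Ip p (fun t => g t - lcomb alpha l t)%R < e%:E)%E.
Proof.
move=> p1 B0 rat mg gB guc e e0.
have p0 : 0 < p by exact: lt_trans p1.
(* Each of the three terms of [bishop_approx_step] is to be at most [e3], hence 3e/4 in all; [e3] <=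
   1 gives e3^p <= e3. *)
set e3 := Num.min 1 (e / 4).
have e30 : 0 < e3 by rewrite lt_min ltr01 divr_gt0.
have e31 : e3 <= 1 by rewrite ge_min lexx.
have e3e : e3 <= e / 4 by rewrite ge_min lexx orbT.
clearbody e3.
(* The budget of five s: change of angle s, Bernstein 2s, oscillation s, regularisation s. *)
have [s s5] : exists s : R, 5 * s = e3 by exists (e3 / 5); rewrite mulrC divfK.
have s0 : 0 < s by lra.
have B1 : 0 < 1 + B by rewrite ltr_wpDr.
have [K1 KP] := archi_upper ((1 + B) `^ p * 2 / e3).
set K := K1.+1; have K0 : (0 < K)%N by [].
have KR0 : 0 < K%:R :> R by rewrite ltr0n.
have KP' : (1 + B) `^ p * (2 / K%:R) <= e3.
  rewrite mulrA ler_pdivrMr // [leRHS]mulrC -ler_pdivrMr //.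
  by apply: le_trans KP _; rewrite ler_nat.
set theta := Num.min 1 (s / (1 + B)).
have th0 : 0 < theta by rewrite lt_min ltr01 divr_gt0.
have th1 : theta <= 1 by rewrite ge_min lexx.
have Bth : B * theta ^+ 2 <= s.
  have th2 : theta * (1 + B) <= s by rewrite -ler_pdivlMr // ge_min lexx orbT.
  have : theta ^+ 2 <= theta by rewrite expr2 ler_piMl // ltW.
  by move=> /(ler_wpM2l B0); nra.
clearbody theta.
set k : R := 2 * K%:R * expR 1.
have k0 : 0 < k by rewrite !mulr_gt0 ?expR_gt0.
(* The first term serves the Bernstein error, the second the coefficient sum. Like [K] and [theta],
   [A] is chosen before q, as [psi_low_dominates] requires. *)
set A := B ^+ 2 / theta ^+ 4 / s ^+ 2 + B / theta + 1.
have A1 : 0 <= B ^+ 2 / theta ^+ 4 / s ^+ 2 by rewrite !divr_ge0 ?exprn_ge0 // ltW.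
have A2 : 0 <= B / theta by rewrite divr_ge0 // ltW.
have A0 : 0 < A by rewrite ltr_wpDl // addr_ge0.
have [hA1 hA2 hA3] : [/\ B ^+ 2 / theta ^+ 4 / s ^+ 2 <= A, B / theta <= A & 1 <= A].
  by rewrite /A; split; lra.
clearbody A.
have [q1 q1P] := psi_low_dominates p1 A0 k0.
have [d d0 dP] := guc s s0.
have [n1 n1P] := archi_upper s^-1.
have [n2 n2P] := archi_upper d^-1.
have [n3 n3P] := archi_upper (2 `^ p * 4 / e3).
have [q [P [qn copP near]]] := rat (q1 + n1 + n2 + n3 + 3)%N.
have [q3 qq1 qn1 qn2 qn3] : [/\ 2 < q, q1 <= q, n1 <= q, n2 <= q & n3 <= q]%N.
  by clear -qn; split; lia.
have q0 : (0 < q)%N by exact: ltn_trans q3.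
have qR0 : 0 < q%:R :> R by rewrite ltr0n.
have qR1 : 1 <= q%:R :> R by rewrite ler1n.
have qs : q%:R^-1 <= s.
  by rewrite invf_ple ?posrE //; apply: le_trans n1P _; rewrite ler_nat.
have qd : q%:R^-1 <= d.
  by rewrite invf_ple ?posrE //; apply: le_trans n2P _; rewrite ler_nat.
have q2p : 2 `^ p * 4 / q%:R <= e3.
  rewrite ler_pdivrMr // [leRHS]mulrC -ler_pdivrMr //.
  by apply: le_trans n3P _; rewrite ler_nat.
set tau := (q%:R ^+ 'C(q, 2) * k ^+ (q * q))^-1.
have [k1 tau0 tau1 small] : [/\ 1 <= k, 0 < tau, tau <= 1 &
   tau * (2 * (K * (q * q))%:R) ^+ (q * q) / (q * q)`!%:R < (q%:R ^+ 'C(q, 2))^-1].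
  exact: sublevel_const.
set N := psi_N p q.
have N0 : (0 < N)%N by exact: psi_N_gt0.
have NR0 : 0 < N%:R :> R by rewrite ltr0n.
have NA : A * (q%:R ^+ (12 * q) * tau^-1 ^+ 4) <= N%:R.
  rewrite mulrA; apply: le_trans (psi_N_ge p1 q3); rewrite invrK.
  exact: q1P.
have Y1 : 1 <= tau^-1 by rewrite -invr1 lef_pV2 ?posrE.
have X1 : 1 <= q%:R ^+ (12 * q) :> R by rewrite exprn_ege1.
(* The errors of q Bernstein polynomials add up, hence the division by q. *)
set th' := s / q%:R; have th'0 : 0 < th' by rewrite divr_gt0.
have := @bishop_approx_step R p alpha q P N K tau theta th' B (psi_delta p q) s g p0
   q0 copP N0 K0 tau0 tau1 th0 th1 th'0 B0 small near mg gB (ltW s0).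
case; first by move=> x y x01 y01 xy; apply: dP => //; exact: le_trans xy qd.
move=> l; set C := q%:R * _; set dd := (q * N + q - 1)%N; set h := dd%:R * psi_delta p q.
set L := 2 * B * _ / _ * _; set err := C * _ + _ + _ => lP.
have ddE : dd = psi_d p q by [].
have C0 : 0 <= C.
  by rewrite !mulr_ge0 ?exprn_ge0 ?invr_ge0 ?mulr_ge0 // ltW.
have CC : C <= psi_C p q.
  apply: le_trans (psi_C_ge p1 q3); rewrite -/N.
  rewrite /C coef_bound_rearrange.
  apply: ler_wpM2r; first by rewrite exprn_ge0.
  apply: ler_wpM2l; first by rewrite mulr_ge0.
  apply: le_trans NA.
  rewrite -mulrA mulrCA.
  apply: ler_pM => //; first by rewrite mulr_ge0 // ltW // invr_gt0.
  have hq : q%:R <= q%:R ^+ (12 * q) :> R by apply: ler_eXnr => //; rewrite muln_gt0.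
  have ht : tau^-1 <= tau^-1 ^+ 4 by exact: ler_eXnr.
  by apply: ler_pM => //; rewrite invr_ge0 ltW.
have BC : B <= psi_C p q.
  apply: (@le_trans _ _ N%:R); last first.
    apply: le_trans (psi_C_ge p1 q3); rewrite -/N.
    rewrite mulrAC; apply: ler_peMl => //.
    have f1 : 1 <= q`!%:R :> R by rewrite ler1n fact_gt0.
    have t1 : 1 <= 3 ^+ N :> R by rewrite exprn_ege1 // ler1n.
    by rewrite !mulr_ege1.
  apply: le_trans NA; rewrite -[leLHS]mulr1; apply: ler_pM => //.
    apply: (@le_trans _ _ (B / theta)) => //.
    by rewrite ler_pdivlMr // ler_piMr.
  by rewrite mulr_ege1 // exprn_ege1.
have h0 : 0 <= h by apply: mulr_ge0 => //; exact: ltW (psi_delta_gt0 p1 q3).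
have errC : C * (dd%:R * h) <= s.
  apply: le_trans qs; apply: le_trans (psi_delta_perturb p1 q3).
  by apply: ler_wpM2r => //; rewrite mulr_ge0.
have errL : q%:R * (th' + L ^+ 2 / (4 * th' * N%:R)) <= s + s.
  rewrite /th' err_rearrange //.
  rewrite lerD2l ler_pdivrMr ?mulr_gt0 //.
  apply: le_trans (lip_sq_le _ q0 th0 tau0) _.
  rewrite mul_s_rearrange.
  rewrite -mulrA ler_pM2l // -ler_pdivrMl ?exprn_gt0 //.
  apply: le_trans NA; rewrite mulrA.
  apply: ler_wpM2r; first by rewrite mulr_ge0 ?exprn_ge0 // invr_ge0 ltW.
  by rewrite mulrC.
have err0 : 0 <= err.
  apply: addr_ge0; last exact: ltW.
  apply: addr_ge0; first by apply: mulr_ge0 => //; apply: mulr_ge0.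
  apply: mulr_ge0; first exact: ltW.
  apply: addr_ge0; first exact: ltW.
  apply: divr_ge0; first exact: sqr_ge0.
  by apply: ltW; apply: mulr_gt0 => //; apply: mulr_gt0.
have err4 : err <= 4 * s by rewrite /err; apply: sum4_le.
clearbody err.
exists l; apply: le_lt_trans lP _; rewrite lte_fin.
have T1 : (err + B * theta ^+ 2) `^ p <= e3.
  apply: (@le_trans _ _ (e3 `^ p)).
    apply: ge0_ler_powR; rewrite ?nnegrE ?(ltW p0) ?(ltW e30) //.
      by rewrite addr_ge0 // mulr_ge0 // sqr_ge0.
    by rewrite -s5; move: err4 Bth; clear; lra.
  rewrite -[leRHS](powRr1 (ltW e30)); apply: ger_powR; last exact: ltW.
  by rewrite e30.
have T2 : (err + B) `^ p * (2 / K%:R) <= e3.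
  apply: le_trans KP'; apply: ler_wpM2r; first by rewrite divr_ge0.
  apply: ge0_ler_powR; rewrite ?nnegrE ?(ltW p0) ?(ltW B1) ?addr_ge0 //.
  by move: err4 s5 e31 s0; clear; lra.
have T3 : (B + C) `^ p * (q.+1%:R * (2 * h)) <= e3.
  apply: le_trans q2p.
  have c0 : 0 <= psi_C p q by exact: le_trans BC.
  apply: (@le_trans _ _ ((2 * psi_C p q) `^ p * (q.+1%:R * (2 * h)))).
    apply: ler_wpM2r; first by apply: mulr_ge0 => //; apply: mulr_ge0.
    apply: ge0_ler_powR; rewrite ?nnegrE; [exact: ltW|exact: addr_ge0|exact: mulr_ge0|].
    by rewrite mulr_natl mulr2n; apply: lerD.
  rewrite powRM // -!mulrA; apply: ler_wpM2l; first exact: powR_ge0.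
  have := psi_delta_measure p1 q3; rewrite -/dd -/h => H.
  rewrite mulrCA (mulrCA _ 2); apply: (@le_trans _ _ (q.+1%:R * (2 * (q%:R ^+ 2)^-1))).
    by rewrite !ler_wpM2l.
  rewrite mulrA ler_pdivrMr ?exprn_gt0 // -mulrA expr2 mulKf ?gt_eqF //.
  by rewrite -natr1; move: qR1; clear; lra.
by move: T1 T2 T3 e3e e0; clear; lra.
Qed.

End Approximation.

(** * Continued fractions *)

Section ContinuedFraction.
Variables (R : realType) (alpha : R).
Hypotheses (a0 : 0 < alpha) (a1 : alpha < 1) (airr : irrational alpha).

Local Notation x := (cf_complete alpha).
Local Notation Q := (cf_den alpha).

(** The numerators of the convergents; they start with 0, 1 because alpha in (0, 1) has integer part
    0. *)
Fixpoint cf_num (n : nat) : nat :=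
  match n with
  | 0 => 0
  | m.+1 => match m with
            | 0 => 1
            | k.+1 => cf_quot alpha n * cf_num m + cf_num k
            end
  end%N.

Lemma cf_completeS n : x n.+1 = (fracpart (x n))^-1.
Proof. by []. Qed.

Lemma cf_complete_irr n : irrational (x n).
Proof.
elim: n => // n IH [r _ rE]; apply: IH.
exists (r^-1 + (Num.floor (x n))%:~R) => //.
rewrite rmorphD /= ratr_int fmorphV /=.
by rewrite rE cf_completeS invrK /fracpart subrK.
Qed.

Lemma fracpart_cf_gt0 n : 0 < fracpart (x n).
Proof.
have /andP[f0 _] := fracpart01 (x n).
rewrite lt_neqAle f0 andbT eq_sym; apply/eqP => f.
apply: (@cf_complete_irr n); exists (Num.floor (x n))%:~R => //.
by rewrite ratr_int; apply/esym/eqP; rewrite -subr_eq0 -/(fracpart _) f.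
Qed.

Lemma cf_complete_gt1 n : 1 < x n.+1.
Proof.
have /andP[_ f1] := fracpart01 (x n).
by rewrite cf_completeS invf_gt1 // fracpart_cf_gt0.
Qed.

Lemma cf_complete_ge0 n : 0 <= x n.
Proof. by case: n => [|n]; [exact: ltW | apply: ltW; exact: lt_trans (cf_complete_gt1 n)]. Qed.

Lemma fracpart_cf n : fracpart (x n) = x n - (cf_quot alpha n)%:R.
Proof.
have /truncn_itv/andP[l u] := cf_complete_ge0 n.
apply: (@fracpart_eq _ _ _ (cf_quot alpha n)); last by rewrite -pmulrn subrK.
by apply/andP; split; move: u; rewrite -natr1 /cf_quot; lra.
Qed.

Lemma cf_quot_gt0 n : (0 < cf_quot alpha n.+1)%N.
Proof. by rewrite /cf_quot truncn_gt0 ltW // cf_complete_gt1. Qed.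

(** The bound n <= Q n turns large indices into large denominators. *)
Lemma cf_den_ge n : (0 < Q n)%N /\ (n <= Q n)%N.
Proof.
suff : (0 < Q n)%N /\ (n <= Q n)%N /\ (0 < Q n.+1)%N /\ (n.+1 <= Q n.+1)%N by tauto.
elim: n => [|n [h1 [h2 [h3 h4]]]].
  by have := cf_quot_gt0 0.
have E : Q n.+2 = (cf_quot alpha n.+2 * Q n.+1 + Q n)%N by [].
have := leq_mul (cf_quot_gt0 n.+1) (leqnn (Q n.+1)); rewrite mul1n => H.
by rewrite E; split => //; split => //; split; lia.
Qed.

Definition cf_err n : R := (Q n)%:R * alpha - (cf_num n)%:R.

(** This is alpha = (x_(n+2) P_(n+1) + P_n) / (x_(n+2) Q_(n+1) + Q_n) without the division. *)
Lemma cf_errS n : cf_err n.+1 * x n.+2 = - cf_err n.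
Proof.
have E m : x m.+1 * (x m - (cf_quot alpha m)%:R) = 1.
  by rewrite cf_completeS fracpart_cf mulVf // -fracpart_cf gt_eqF // fracpart_cf_gt0.
elim: n => [|n IH].
  have x1 : x 1 = alpha^-1.
    by rewrite cf_completeS fracpart_id // (ltW a0) a1.
  have := E 1%N; rewrite x1 => E1.
  have {}E1 : x 2 * (1 - (cf_quot alpha 1)%:R * alpha) = alpha.
    transitivity (x 2 * (alpha^-1 - (cf_quot alpha 1)%:R) * alpha).
      by rewrite -mulrA; congr (_ * _); rewrite mulrBl mulVf // gt_eqF.
    by rewrite E1 mul1r.
  have e1 : cf_err 1 = (cf_quot alpha 1)%:R * alpha - 1 by [].
  have e0 : cf_err 0 = alpha by rewrite /cf_err mul1r subr0.
  by rewrite e1 e0 -[in RHS]E1; ring.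
have EQ : cf_err n.+2 = (cf_quot alpha n.+2)%:R * cf_err n.+1 + cf_err n.
  by rewrite /cf_err -[Q n.+2]/(cf_quot alpha n.+2 * Q n.+1 + Q n)%N
    -[cf_num n.+2]/(cf_quot alpha n.+2 * cf_num n.+1 + cf_num n)%N !natrD !natrM; ring.
rewrite EQ (_ : cf_err n = - (cf_err n.+1 * x n.+2)); last by rewrite IH opprK.
have E2 := E n.+2.
have -> : - cf_err n.+1 = - cf_err n.+1 * (x n.+3 * (x n.+2 - (cf_quot alpha n.+2)%:R)) by rewrite E2 mulr1.
move: (x n.+3) (x n.+2) (cf_err n.+1) (cf_quot _ _)%:R => u v w z; ring.
Qed.

Lemma cf_det n :
  (cf_num n.+1 * Q n)%:R - (cf_num n * Q n.+1)%:R = (-1) ^+ n :> R.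
Proof.
elim: n => [|n IH]; first by rewrite /= !mul1n mul0n subr0 expr0.
rewrite -[Q n.+2]/(cf_quot alpha n.+2 * Q n.+1 + Q n)%N
    -[cf_num n.+2]/(cf_quot alpha n.+2 * cf_num n.+1 + cf_num n)%N.
by rewrite exprS -IH !natrM !natrD !natrM; ring.
Qed.

Lemma cf_coprime n : coprime (cf_num n) (Q n).
Proof.
have d1 := dvdn_mulr (Q n.+1) (dvdn_gcdl (cf_num n) (Q n)).
have d2 := dvdn_mull (cf_num n.+1) (dvdn_gcdr (cf_num n) (Q n)).
rewrite /coprime -dvdn1; have := cf_det n; rewrite -signr_odd; case: (odd n) => /=.
  rewrite expr1 => h.
  have /eqP : (cf_num n * Q n.+1)%:R = (cf_num n.+1 * Q n + 1)%:R :> R by rewrite natrD; lra.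
  by rewrite eqr_nat => /eqP E; rewrite -(dvdn_addr _ d2) -E.
rewrite expr0 => h.
have /eqP : (cf_num n.+1 * Q n)%:R = (cf_num n * Q n.+1 + 1)%:R :> R by rewrite natrD; lra.
by rewrite eqr_nat => /eqP E; rewrite -(dvdn_addr _ d1) -E.
Qed.

(** Eliminating the next error between [cf_errS] and [cf_det] shows that [cf_err n] times Q_(n+1) +
    Q_n / x_(n+2) is 1 or -1, and the second summand is positive. *)
Lemma cf_approx n :
  `|alpha - (cf_num n)%:R / (Q n)%:R| < ((Q n)%:R * (Q n.+1)%:R)^-1.
Proof.
have [q0 _] := cf_den_ge n; have [q1 _] := cf_den_ge n.+1.
have Q0 : 0 < (Q n)%:R :> R by rewrite ltr0n.
have Q1 : 0 < (Q n.+1)%:R :> R by rewrite ltr0n.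
have x2 : 0 < x n.+2 by apply: lt_trans (cf_complete_gt1 n.+1).
have E : cf_err n * ((Q n.+1)%:R + (Q n)%:R / x n.+2) = (-1) ^+ n.
  have -> : cf_err n * ((Q n.+1)%:R + (Q n)%:R / x n.+2)
    = (Q n.+1)%:R * cf_err n - (Q n)%:R * cf_err n.+1.
    have -> : cf_err n.+1 = - (cf_err n / x n.+2).
      by rewrite -mulNr -cf_errS mulfK // gt_eqF.
    by ring.
  by rewrite -cf_det !natrM /cf_err; ring.
have Qx : 0 < (Q n)%:R / x n.+2 by rewrite divr_gt0.
have e : `|cf_err n| < (Q n.+1)%:R^-1.
  have := congr1 Num.norm E; rewrite normrX normrN1 expr1n normrM.
  rewrite [X in _ * X]gtr0_norm ?addr_gt0 // => N1.
  have ce0 : 0 < `|cf_err n|.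
    by rewrite -(pmulr_lgt0 _ (addr_gt0 Q1 Qx)) N1 ltr01.
  have H : `|cf_err n| * (Q n.+1)%:R < 1.
    by rewrite -[ltRHS]N1 ltr_pM2l // ltrDl.
  by rewrite -[ltRHS]mul1r ltr_pdivlMr.
have -> : alpha - (cf_num n)%:R / (Q n)%:R = cf_err n / (Q n)%:R.
  by rewrite /cf_err; field; rewrite gt_eqF.
by rewrite normrM normfV (gtr0_norm Q0) invfM mulrC ltr_pM2l // invr_gt0.
Qed.

End ContinuedFraction.

Lemma rational_approximations (R : realType) (p alpha : R) :
  1 < p -> 0 < alpha -> alpha < 1 -> irrational alpha ->
  (forall n : nat, exists2 n0 : nat,
     (n <= n0)%N & psi1 p (cf_den alpha n0) < (cf_den alpha n0.+1)%:R) ->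
  forall n : nat, exists q P : nat, [/\ (n <= q)%N, coprime P q &
      `|alpha - P%:R / q%:R| <= psi_delta p q].
Proof.
move=> p1 a0 a1 airr conv n.
(* The shift by 3 forces q >= 3, where [psi_eta] has its general form. *)
have [n0 nn0 psi] := conv (n + 3)%N.
set q := cf_den alpha n0 in psi *.
have [q0 qn0] := cf_den_ge a0 a1 airr n0; rewrite -/q in q0 qn0.
have q3 : (2 < q)%N by lia.
exists q, (cf_num alpha n0); split; first by lia.
  exact: cf_coprime.
apply: ltW; apply: lt_trans (cf_approx a0 a1 airr n0) _.
have Q0 : 0 < q%:R :> R by rewrite ltr0n.
have d0 := psi_delta_gt0 p1 q3.
move: psi; rewrite /psi1 leqNgt (ltn_trans _ q3) //= => psi.
have Q1 : 0 < (cf_den alpha n0.+1)%:R :> R.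
  by apply: lt_trans psi; rewrite divr_gt0 // mulr_gt0.
move: psi; rewrite ltr_pdivrMr ?mulr_gt0 // -/q => psi.
rewrite -[ltLHS]mul1r ltr_pdivrMr ?mulr_gt0 //.
by rewrite [ltRHS](_ : _ = (cf_den alpha n0.+1)%:R * (q%:R * psi_delta p q)) //; ring.
Qed.

(** * Density *)

Section Density.
Variable R : realType.
Local Notation mu := (@lebesgue_measure R).
Local Notation D01 := (`[0, 1]%classic : set R).
Let mD01 : measurable D01. Proof. exact: measurable_itv. Qed.

Lemma continuous_unif01 (g : R -> R) : continuous g ->
  forall s : R, 0 < s -> exists2 d : R, 0 < d &
    forall x y : R, 0 <= x <= 1 -> 0 <= y <= 1 -> `|x - y| <= d -> `|g x - g y| <= s.
Proof.
move=> cg s s0.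
have /compact_near_coveringP nc := @segment_compact R 0 1.
pose P (n : nat) (x : R) := forall y : R, `|x - y| <= n.+1%:R^-1 -> `|g x - g y| <= s.
have s20 : 0 < s / 2 by rewrite divr_gt0.
have [] : \forall n \near \oo, D01 `<=` P n.
  apply: nc => x0 _.
  have /cvgrPdist_lt /(_ _ s20) /nbhs_ballP[d /= d0 dP] := cg x0.
  have d20 : 0 < d / 2 by rewrite divr_gt0.
  exists (ball x0 (d / 2), [set n | n.+1%:R^-1 < d / 2]) => /=.
    split; first exact: nbhsx_ballx.
    exact: near_infty_natSinv_lt (PosNum d20).
  move=> [x n] /= [bx bn] y xy.
  have bx' : ball x0 d x by apply: le_ball bx; rewrite ler_pdivrMr // mulr_natr mulr2n lerDl ltW.
  have by' : ball x0 d y.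
    rewrite -ball_normE /= in bx *.
    rewrite (_ : x0 - y = (x0 - x) + (x - y)); last by ring.
    apply: le_lt_trans (ler_normD _ _) _.
    rewrite [ltRHS](splitr d); apply: ltrD => //; exact: le_lt_trans bn.
  rewrite (_ : g x - g y = (g x0 - g y) - (g x0 - g x)); last by ring.
  apply: le_trans (ler_normB _ _) _; rewrite [leRHS](splitr s).
  by apply: lerD; apply: ltW; apply: dP.
move=> n _ /(_ n (leqnn n)) nP.
exists n.+1%:R^-1; first by rewrite invr_gt0.
by move=> x y x01 _ xy; apply: nP => //=; rewrite in_itv.
Qed.

Variables (p alpha : R).
Hypothesis p1 : 1 < p.
Let p0 : 0 < p. Proof. exact: lt_trans p1. Qed.

Definition cyclic_approx (f : R -> R) :=
  forall e : R, 0 < e -> exists l, (Ip p (fun t => f t - lcomb alpha l t)%R < e%:E)%E.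

Lemma Ip_add_le (f g h : R -> R) : measurable_fun D01 f -> measurable_fun D01 g ->
  measurable_fun D01 h ->
  (forall t, `|h t| <= `|f t| + `|g t|) ->
  (Ip p h <= (2 `^ p)%:E * (Ip p f + Ip p g))%E.
Proof.
move=> mf mg mh hfg.
have mp (u : R -> R) : measurable_fun D01 u -> measurable_fun D01 (EFin \o (fun x : R => `|u x| `^ p)).
  by move=> mu'; exact: measurable_powR_norm.
rewrite /Ip -ge0_integralD //; try by [exact: mp|move=> x _; rewrite lee_fin powR_ge0].
rewrite -ge0_integralZl_EFin ?powR_ge0 //; last 2 first.
- by move=> x _; rewrite adde_ge0 // lee_fin powR_ge0.
- by apply: emeasurable_funD; exact: mp.
apply: ge0_le_integral => //.
- exact: mp.
- apply: emeasurable_funM => //; apply: emeasurable_funD; exact: mp.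
move=> x _; rewrite -EFinD -EFinM lee_fin.
apply: (@le_trans _ _ ((2 * Num.max `|f x| `|g x|) `^ p)).
  apply: ge0_ler_powR; rewrite ?nnegrE ?(ltW p0) // ?mulr_ge0 // ?le_max ?normr_ge0 //.
  apply: le_trans (hfg x) _; rewrite mulr_natl mulr2n.
  by apply: lerD; rewrite le_max lexx ?orbT.
rewrite powRM // ?le_max ?normr_ge0 //; apply: ler_wpM2l; first exact: powR_ge0.
have [_|_] := leP `|f x| `|g x|; by rewrite ?lerDl ?lerDr powR_ge0.
Qed.

Lemma cyclic_approx_limit (f : R -> R) : measurable_fun D01 f ->
  (forall e : R, 0 < e -> exists g, [/\ measurable_fun D01 g, cyclic_approx g &
     (Ip p (fun t => f t - g t)%R < e%:E)%E]) -> cyclic_approx f.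
Proof.
move=> mf H e e0.
set c := 2 `^ p; have c0 : 0 < c by rewrite powR_gt0.
have e'0 : 0 < e / (2 * c) by rewrite divr_gt0 // mulr_gt0.
have [g [mg ag fg]] := H _ e'0; have [l gl] := ag _ e'0; exists l.
have ml : measurable_fun D01 (lcomb alpha l).
  by apply: measurable_funTS; exact: measurable_lcomb.
apply: le_lt_trans (Ip_add_le (f := fun t => f t - g t) (g := fun t => g t - lcomb alpha l t) _ _ _ _) _.
- exact: measurable_funB.
- exact: measurable_funB.
- exact: measurable_funB.
- by move=> t; rewrite (_ : f t - lcomb alpha l t = (f t - g t) + (g t - lcomb alpha l t)) ?ler_normD //; ring.
have -> : e%:E = (c%:E * ((e / (2 * c))%:E + (e / (2 * c))%:E))%E.
  by rewrite -EFinD -EFinM; congr EFin; field; rewrite gt_eqF.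
by rewrite lte_pmul2l // ?lte_fin //; exact: lteD.
Qed.

Hypothesis rat : forall n : nat, exists q P : nat, [/\ (n <= q)%N, coprime P q &
      `|alpha - P%:R / q%:R| <= psi_delta p q].

Lemma cyclic_approx_continuous (B : R) (g : R -> R) : 0 <= B -> continuous g ->
  (forall t : R, 0 <= t <= 1 -> `|g t| <= B) -> cyclic_approx g.
Proof.
move=> B0 cg gB; apply: (approx_uniformly_continuous p1 B0 rat _ gB).
  by apply: measurable_funTS; exact: continuous_measurable_fun.
exact: continuous_unif01.
Qed.

Definition clip (B x : R) := Num.max (- B) (Num.min B x).

Lemma clip_norm_le B x : 0 <= B -> `|clip B x| <= B.
Proof.
move=> B0; rewrite ler_norml /clip le_max lexx /= ge_max ge_min lexx /= andbT.
by lra.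
Qed.

Lemma clip_dist_le B x y : 0 <= B -> `|x| <= B -> `|x - clip B y| <= `|x - y|.
Proof.
move=> B0; rewrite ler_norml => /andP[x1 x2]; rewrite /clip.
have [By|yB] := leP B y.
  have -> : Num.max (- B) B = B by apply/max_idPr; lra.
  by rewrite ler0_norm ?ler0_norm; lra.
have [yb|by_] := leP (- B) y.
  by [].
by rewrite ger0_norm ?ger0_norm; lra.
Qed.

Lemma clip_residue_le B x : 0 <= B -> `|x - clip B x| <= `|x|.
Proof.
move=> B0; rewrite /clip; have [Bx|xB] := leP B x.
  have -> : Num.max (- B) B = B by apply/max_idPr; lra.
  by rewrite !ger0_norm; lra.
have [xb|bx] := leP (- B) x; first by rewrite subrr normr0.
by rewrite !ler0_norm; lra.
Qed.

Lemma clip_id B x : `|x| <= B -> clip B x = x.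
Proof.
rewrite ler_norml => /andP[x1 x2]; rewrite /clip.
by rewrite (min_idPr x2); apply/max_idPr.
Qed.

(** Continuous functions approximate f in L^1. Clipping them at B keeps them continuous and no
    farther from f, and then |f - g|^p <= (2B)^(p-1) |f - g| upgrades L^1 to L^p. *)
Lemma cyclic_approx_bounded (B : R) (f : R -> R) : 0 < B -> measurable_fun D01 f ->
  (forall t : R, 0 <= t <= 1 -> `|f t| <= B) -> cyclic_approx f.
Proof.
move=> B0 mf fB; apply: cyclic_approx_limit => // e e0.
have intf : mu.-integrable D01 (EFin \o f).
  apply: measurable_bounded_integrable => //.
    by rewrite [X in (X < _)%E](_ : _ = 1%E) ?ltry //; exact: mu_D01.
  exists B; split; first exact: num_real.
  by move=> x Bx t /=; rewrite in_itv => /fB /le_trans; apply; exact: ltW.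
have fin : (mu D01 < +oo)%E by rewrite mu_D01 ltry.
have [g_ [cg ig gf]] := approximation_continuous_integrable mD01 fin intf.
set c := (2 * B) `^ (p - 1); have c0 : 0 < c by rewrite powR_gt0 // mulr_gt0.
have e'0 : 0 < e / c by rewrite divr_gt0.
have [n gn] : exists n, (\int[mu]_(z in D01) `|(f z - g_ n z)%:E| < (e / c)%:E)%E.
  move: gf => /fine_cvgP[fn /cvgrPdist_lt /(_ _ e'0) gn].
  have [n _ /(_ n (leqnn n)) [nfin]] : \forall n \near \oo,
      (\int[mu]_(z in D01) `|(f z - g_ n z)%:E|)%E \is a fin_num /\
      `|0 - fine (\int[mu]_(z in D01) `|(f z - g_ n z)%:E|)%E| < e / c.
    by near=> n; split; near: n.
  rewrite sub0r normrN => nlt; exists n.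
  by rewrite -(fineK nfin) lte_fin; apply: le_lt_trans nlt; exact: ler_norm.
pose g t := clip B (g_ n t).
have gB t : `|g t| <= B by apply: clip_norm_le; exact: ltW.
have cgc : continuous g.
  move=> t; apply: (@continuous_max _ _ (cst (- B)) (fun t => Num.min B (g_ n t))).
    exact: cst_continuous.
  apply: (@continuous_min _ _ (cst B) (g_ n)); first exact: cst_continuous.
  exact: cg.
have mg : measurable_fun D01 g by apply: measurable_funTS; exact: continuous_measurable_fun.
have mgn : measurable_fun D01 (g_ n).
  by apply: measurable_funTS; exact: continuous_measurable_fun.
exists g; split => //.
  by apply: (@cyclic_approx_continuous B) => //; exact: ltW.
apply: (@le_lt_trans _ _ (c%:E * \int[mu]_(z in D01) `|(f z - g_ n z)%:E|)%E); last first.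
  by rewrite muleC -lte_pdivlMr // -EFinM.
rewrite -ge0_integralZl_EFin //; last 2 first.
- apply: measurableT_comp => //; apply/measurable_EFinP; exact: measurable_funB.
- exact: ltW.
apply: ge0_le_integral => //.
- by apply: measurable_powR_norm => //; exact: measurable_funB.
- apply: emeasurable_funM => //; apply: measurableT_comp => //.
  by apply/measurable_EFinP; exact: measurable_funB.
move=> x; rewrite /= in_itv /= => x01; rewrite lee_fin.
have d1 : `|f x - g x| <= `|f x - g_ n x|.
  by apply: clip_dist_le; [exact: ltW|exact: fB].
have d2 : `|f x - g x| <= 2 * B.
  by apply: le_trans (ler_normB _ _) _; rewrite mulr_natl mulr2n lerD // fB.
rewrite -[p in leLHS](subrK 1) powRD; last by rewrite subrK gt_eqF.
rewrite powRr1 //; apply: ler_pM => //; rewrite ?powR_ge0 //.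
by apply: ge0_ler_powR; rewrite ?nnegrE ?subr_ge0 ?(ltW p1) // mulr_ge0 // ltW.
Unshelve. all: by end_near. Qed.

(** Truncations of f agree with f eventually at each point, and |f|^p dominates the p-th powers of
    the differences. *)
Lemma cyclic_approx_Lp (f : R -> R) : measurable_fun D01 f -> (Ip p f < +oo)%E ->
  cyclic_approx f.
Proof.
move=> mf fp; apply: cyclic_approx_limit => // e e0.
pose g (n : nat) t : R := clip n.+1%:R (f t).
have cclip B : continuous (clip B).
  move=> t; apply: (@continuous_max _ _ (cst (- B)) (fun t => Num.min B t)).
    exact: cst_continuous.
  by apply: (@continuous_min _ _ (cst B) id); [exact: cst_continuous|exact: id].
have mg n : measurable_fun D01 (g n).
  by apply: (measurableT_comp _ mf); exact: continuous_measurable_fun.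
have mfg n : measurable_fun D01 (fun t => f t - g n t) by exact: measurable_funB.
have intf : mu.-integrable D01 (EFin \o (fun t => `|f t| `^ p)).
  apply/integrableP; split; first exact: measurable_powR_norm.
  apply: le_lt_trans fp; rewrite /Ip le_eqVlt; apply/orP; left; apply/eqP.
  by apply: eq_integral => t _ /=; rewrite ger0_norm ?powR_ge0.
pose h (n : nat) t := (`|f t - g n t| `^ p)%:E.
have mh n : measurable_fun D01 (h n) by exact: measurable_powR_norm.
have hcv : {ae mu, forall x, D01 x -> h ^~ x @ \oo --> (0%E : \bar R)}.
  apply: aeW => x _; apply: cvg_near_cst.
  exists (Num.truncn `|f x|) => // n /= xn.
  rewrite /h /g clip_id ?subrr ?normr0 ?powR0 ?gt_eqF //.
  by apply: le_trans (ltW (truncnS_gt _)) _; rewrite ler_nat ltnS.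
have hdom : {ae mu, forall x n, D01 x -> (`|h n x| <= (`|f x| `^ p)%:E)%E}.
  apply: aeW => x n _; rewrite /h gee0_abs ?lee_fin ?powR_ge0 //.
  apply: ge0_ler_powR; rewrite ?nnegrE ?(ltW p0) //.
  exact: clip_residue_le.
have m0 : measurable_fun D01 (fun=> 0%E : \bar R) by exact: measurable_cst.
have [_ _ cv] := @dominated_convergence _ _ _ mu D01 mD01 h (fun=> 0%E) _ mh m0 hcv intf hdom.
have [n gn] : exists n, (Ip p (fun t => (f t - g n t)%R) < e%:E)%E.
  move: cv; rewrite integral0 => /fine_cvgP[fn /cvgrPdist_lt /(_ _ e0) gn].
  have [n _ /(_ n (leqnn n)) [nfin]] : \forall n \near \oo,
      (\int[mu]_(x in D01) h n x)%E \is a fin_num /\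
      `|0 - fine (\int[mu]_(x in D01) h n x)%E| < e.
    by near=> n; split; near: n.
  rewrite sub0r normrN => nlt; exists n.
  by rewrite /Ip -(fineK nfin) lte_fin; apply: le_lt_trans nlt; exact: ler_norm.
exists (g n); split => //.
apply: (@cyclic_approx_bounded n.+1%:R) => // t _.
by apply: clip_norm_le.
Unshelve. all: by end_near. Qed.

End Density.

(** * Complex-valued functions *)

Section ComplexLp.
Variable R : realType.
Local Notation mu := (@lebesgue_measure R).
Local Notation D01 := (`[0, 1]%classic : set R).
Let mD01 : measurable D01. Proof. exact: measurable_itv. Qed.
Local Notation normc := (@Normc.normc R).
Implicit Types f : R -> R[i].

Lemma normcE (z : R[i]) : normc z = Num.sqrt (complex.Re z ^+ 2 + complex.Im z ^+ 2).
Proof. by case: z. Qed.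

Lemma normc_ge0 (z : R[i]) : 0 <= normc z.
Proof. by rewrite normcE sqrtr_ge0. Qed.

Lemma norm_Re_le (z : R[i]) : `|complex.Re z| <= normc z.
Proof. by rewrite normcE -sqrtr_sqr ler_wsqrtr // lerDl sqr_ge0. Qed.

Lemma norm_Im_le (z : R[i]) : `|complex.Im z| <= normc z.
Proof. by rewrite normcE -sqrtr_sqr ler_wsqrtr // lerDr sqr_ge0. Qed.

Lemma normc_le_ReIm (z : R[i]) : normc z <= `|complex.Re z| + `|complex.Im z|.
Proof.
rewrite normcE -[leRHS]ger0_norm ?addr_ge0 // -sqrtr_sqr ler_wsqrtr //.
rewrite -[complex.Re z ^+ 2]real_normK ?num_real // -[complex.Im z ^+ 2]real_normK ?num_real //.
by rewrite sqrrD addrAC lerDl mulrn_wge0 // mulr_ge0.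
Qed.

Lemma measurable_normc f :
  measurable_fun setT (fun x => complex.Re (f x)) ->
  measurable_fun setT (fun x => complex.Im (f x)) ->
  measurable_fun setT (fun x => normc (f x)).
Proof.
move=> mRe mIm.
rewrite (_ : (fun x => normc (f x)) =
   Num.sqrt \o (fun x => complex.Re (f x) ^+ 2 + complex.Im (f x) ^+ 2)); last first.
  by apply/funext => x; rewrite normcE.
apply: measurableT_comp; first by apply: continuous_measurable_fun; exact: sqrt_continuous.
by apply: measurable_funD; exact: measurable_funX.
Qed.

Lemma cLnorm_powR (p : R) f : 0 < p ->
  measurable_fun setT (fun x => complex.Re (f x)) ->
  measurable_fun setT (fun x => complex.Im (f x)) ->
  (cLnorm (leb01 R) p f `^ p = Ip p (fun x => normc (f x)))%E.
Proof.
move=> p0 mRe mIm; rewrite /cLnorm poweR_Lnorm ?gt_eqF //.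
transitivity (\int[leb01 R]_x (`|normc (f x)| `^ p)%:E)%E; first exact: eq_integral.
rewrite leb01_integral //.
  by apply: measurable_powR_norm => //; exact: measurable_normc.
Qed.

Lemma cLnorm_lt (p e : R) f : 0 < p -> 0 < e ->
  measurable_fun setT (fun x => complex.Re (f x)) ->
  measurable_fun setT (fun x => complex.Im (f x)) ->
  (Ip p (fun x => normc (f x)) < (e `^ p)%:E)%E -> (cLnorm (leb01 R) p f < e%:E)%E.
Proof.
move=> p0 e0 mRe mIm; rewrite -cLnorm_powR //; rewrite !ltNge; apply: contra => eN.
rewrite -poweR_EFin; apply: gt0_ler_poweR; rewrite ?(ltW p0) // in_itv /= leey andbT.
  by rewrite lee_fin ltW.
exact: Lnorm_ge0.
Qed.

Lemma cLfun_Re (p : R) f : 0 < p -> cLfun (leb01 R) p f ->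
  (Ip p (fun x => complex.Re (f x)) < +oo)%E /\ (Ip p (fun x => complex.Im (f x)) < +oo)%E.
Proof.
move=> p0 [mRe mIm fp].
have Nfin : (Ip p (fun x => normc (f x)) < +oo)%E.
  by rewrite -cLnorm_powR //; exact: poweR_lty.
have mn := measurable_normc mRe mIm.
by split; apply: le_lt_trans Nfin; apply: ge0_le_integral => //;
  try (by apply: measurable_powR_norm => //; exact: measurable_funTS);
  move=> x _; rewrite lee_fin; apply: ge0_ler_powR;
  rewrite ?nnegrE ?(ltW p0) // [leRHS]ger0_norm ?normc_ge0 ?norm_Re_le ?norm_Im_le.
Qed.

Definition ccomb (l1 l2 : seq (R * nat)) : seq (R[i] * nat) :=
  [seq (y.1%:C%C, y.2) | y <- l1] ++ [seq ((0 +i* y.1)%C, y.2) | y <- l2].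

Lemma ccombE (alpha : R) l1 l2 x :
  \sum_(y <- ccomb l1 l2) y.1 * iter y.2 (bishop alpha) (fun=> 1) x
  = (lcomb alpha l1 x +i* lcomb alpha l2 x)%C.
Proof.
rewrite /ccomb big_cat /= !big_map /=.
have -> : \sum_(y <- l1) y.1%:C%C * iter y.2 (bishop alpha) (fun=> 1) x
    = (lcomb alpha l1 x)%:C%C.
  rewrite /lcomb rmorph_sum; apply: eq_bigr => y _.
  by rewrite iter_bishop_bis rmorphM.
have -> : \sum_(y <- l2) (0 +i* y.1)%C * iter y.2 (bishop alpha) (fun=> 1) x
    = (0 +i* lcomb alpha l2 x)%C.
  rewrite /lcomb; elim: l2 => [|y l2 IH]; first by rewrite !big_nil.
  by rewrite !big_cons IH iter_bishop_bis; simpc.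
by simpc.
Qed.

Lemma ccomb_cspan (alpha : R) l1 l2 :
  cspan [set iter n (bishop alpha) (fun=> 1) | n in [set: nat]]
    (fun x => (lcomb alpha l1 x +i* lcomb alpha l2 x)%C).
Proof.
pose L := ccomb l1 l2; pose y k := nth (0, 0%N) L k.
exists (size L), (fun k => (y k).1), (fun k => iter (y k).2 (bishop alpha) (fun=> 1)).
split; first by move=> k; exists (y k).2.
apply/funext => x; rewrite -ccombE (big_nth (0, 0%N)) big_mkord.
by [].
Qed.

End ComplexLp.

Theorem theorem8 (R : realType) (p alpha : R)
  (hp : 1 < p) (halpha0 : 0 < alpha) (halpha1 : alpha < 1)
  (halpha : irrational alpha)
  (hconv : forall n : nat, exists2 n0 : nat,
     (n <= n0)%N & psi1 p (cf_den alpha n0) < (cf_den alpha n0.+1)%:R) :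
  cyclic_vector (leb01 R) p (bishop alpha) (fun=> 1).
Proof.
have p0 : 0 < p by exact: lt_trans hp.
have mD01 : measurable (`[0, 1]%classic : set R) by exact: measurable_itv.
have rat := rational_approximations hp halpha0 halpha1 halpha hconv.
split.
  have mRe : measurable_fun setT (fun x : R => complex.Re (1 : R[i])) by exact: measurable_cst.
  have mIm : measurable_fun setT (fun x : R => complex.Im (1 : R[i])) by exact: measurable_cst.
  split => //; apply: (@lty_poweRy _ _ p); rewrite ?gt_eqF // cLnorm_powR //.
  rewrite /Ip Normc.normc1 normr1 powR1 integral_cst // mul1e.
  by rewrite [X in (X < _)%E](_ : _ = 1%E) ?ltry //; exact: mu_D01.
apply/seteqP; split=> [f [] //|f fL]; split => // e e0.
have [mRe mIm _] := fL; have [fRe fIm] := cLfun_Re p0 fL.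
have c0 : 0 < 2 `^ p :> R by rewrite powR_gt0.
(* Real and imaginary parts are approximated separately; [d] absorbs the 2^p of [Ip_add_le]. *)
set d := e `^ p / (2 * 2 `^ p).
have d0 : 0 < d by rewrite divr_gt0 ?powR_gt0 // mulr_gt0.
have mT (g : R -> R) : measurable_fun setT g -> measurable_fun (`[0, 1]%classic : set R) g.
  by move=> mg; exact: measurable_funTS.
have [l1 l1P] := cyclic_approx_Lp hp rat (mT _ mRe) fRe d0.
have [l2 l2P] := cyclic_approx_Lp hp rat (mT _ mIm) fIm d0.
exists (fun x => (lcomb alpha l1 x +i* lcomb alpha l2 x)%C); first exact: ccomb_cspan.
have E x : f x - (lcomb alpha l1 x +i* lcomb alpha l2 x)%C =
    ((complex.Re (f x) - lcomb alpha l1 x) +i* (complex.Im (f x) - lcomb alpha l2 x))%C.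
  by case: (f x) => a b; simpc.
have m1 : measurable_fun setT (fun x => complex.Re (f x) - lcomb alpha l1 x).
  by apply: measurable_funB => //; exact: measurable_lcomb.
have m2 : measurable_fun setT (fun x => complex.Im (f x) - lcomb alpha l2 x).
  by apply: measurable_funB => //; exact: measurable_lcomb.
have -> : (fun x => f x - (lcomb alpha l1 x +i* lcomb alpha l2 x)%C) = (fun x =>
    ((complex.Re (f x) - lcomb alpha l1 x) +i* (complex.Im (f x) - lcomb alpha l2 x))%C).
  by apply/funext => x.
apply: cLnorm_lt => //.
apply: le_lt_trans (Ip_add_le hp (mT _ m1) (mT _ m2) _ _) _.
- by apply: mT; exact: (@measurable_normc _ (fun x =>
    ((complex.Re (f x) - lcomb alpha l1 x) +i* (complex.Im (f x) - lcomb alpha l2 x))%C)).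
- by move=> t; rewrite ger0_norm ?normc_ge0 //; exact: normc_le_ReIm.
have -> : (e `^ p)%:E = ((2 `^ p)%:E * (d%:E + d%:E))%E.
  by rewrite -EFinD -EFinM; congr EFin; rewrite /d; field; rewrite gt_eqF.
by rewrite lte_pmul2l // ?lte_fin //; exact: lteD.
Qed.
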